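(* $\mathsf{CD}^+_{\mathrm T}$ and $\mathsf{CKF}_{\mathsf{cs}}$ are identical theories, i.e. they prove exactly the same $\mathcal L_{\mathrm T}$-sentences.
   Context: **Language and notation.** $\mathcal L_{\mathbb N}$ is the language of arithmetic over $\{\bar 0,\mathrm S,+,\times\}$ with finitely many additional function symbols for elementary syntactic operations: $\mathrm{num}$ (sending $n$ to the code of its numeral) and functions sending codes of expressions to the codes of their negation, conjunction, universal quantification, and the code of a term $t$ to the code of the atomic formula $\mathrm T(t)$, etc. $\mathcal L_{\mathrm T}=\mathcal L_{\mathbb N}\cup\{\mathrm T\}$ with $\mathrm T$ a unary predicate. A Gödel numbering is fixed and expressions are identified with their codes. Logical primitives are $\neg,\wedge,\forall$, the others being defined. In axioms, $s,t$ range over codes of closed terms and $t^\circ$ is the value of $t$; $\varphi,\psi$ range over codes of sentences of $\mathcal L_{\mathrm T}$; $\varphi(v)$ ranges over codes of formulas with at most the variable $v$ free; $\varphi(t/v)$ is substitution. Connectives and predicates inside $\mathrm T$ (or $\mathrm D$) denote the corresponding syntactic operations on codes. $\mathrm F x:=\mathrm T(\neg x)$ (with $\neg$ the syntactic negation function). $\mathrm T\mathrm T\varphi$ and $\mathrm T\mathrm F\varphi$ are $\mathrm T$ applied to the code of $\mathrm T(\mathrm{num}(\varphi))$, resp. of $\mathrm F(\mathrm{num}(\varphi))$. For $t$ a closed term code, $\mathrm T\mathrm T t$ and $\mathrm T\mathrm F t$ are $\mathrm T$ applied to the code of the sentence $\mathrm T(t)$, resp. $\mathrm F(t)$; and $\mathrm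 T\mathrm T\mathrm T t$, $\mathrm T\mathrm F\mathrm T t$ are $\mathrm T\mathrm T\varphi$, $\mathrm T\mathrm F\varphi$ for $\varphi$ the sentence $\mathrm T(t)$. **$\mathsf{CD}^+_{\mathrm T}$** is the $\mathcal L_{\mathrm T}$-theory consisting of $\mathsf{PA}$ with induction for all $\mathcal L_{\mathrm T}$-formulas and the following axioms, where $\mathrm D$ is defined by $\mathrm D x:\leftrightarrow \mathrm T\mathrm T x\vee\mathrm T\mathrm F x$ (that is, $\mathrm T$ holds of the code of $\mathrm T(\mathrm{num}(x))$ or of the code of $\mathrm F(\mathrm{num}(x))$), and $\mathrm D t$ inside $\mathrm T$ or $\mathrm D$ is the code of the defining formula applied to $t$: - (T1) $\forall s\forall t(\mathrm T(s=t)\leftrightarrow s^\circ=t^\circ)$ - (T2$^+$) $\forall t(\mathrm D t^\circ\leftrightarrow \mathrm T\mathrm D t)$ - (T3) $\forall t(\mathrm D t^\circ\to(\mathrm T\mathrm T t\leftrightarrow \mathrm T t^\circ))$ - (T4) $\forall\varphi(\mathrm T(\neg\varphi)\leftrightarrow\neg\mathrm T\varphi)$ - (T5) $\forall\varphi,\psi(\mathrm T(\varphi\wedge\psi)\leftrightarrow \mathrm T\varphi\wedge\mathrm T\psi)$ - (T6) $\forall\varphi(v)(\mathrm T(\forall v\varphi)\leftrightarrow\forall t\,\mathrm T\varphi(t/v))$ - (D1) $\forall s\forall t\,\mathrm D(s=t)$ - (D2) $\forall t(\mathrm D\mathrm T t\leftrightarrow\mathrm D t^\circ)$ - (D3) $\forall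 t(\mathrm D\mathrm D t\leftrightarrow\mathrm D t^\circ)$ - (D4) $\forall\varphi(\mathrm D(\neg\varphi)\leftrightarrow\mathrm D\varphi)$ - (D5) $\forall\varphi,\psi\big(\mathrm D(\varphi\wedge\psi)\leftrightarrow((\mathrm D\varphi\wedge\mathrm D\psi)\vee(\mathrm D\varphi\wedge\mathrm T\neg\varphi)\vee(\mathrm D\psi\wedge\mathrm T\neg\psi))\big)$ - (D6) $\forall\varphi(v)\big(\mathrm D(\forall v\varphi)\leftrightarrow(\forall t\,\mathrm D\varphi(t/v)\vee\exists t(\mathrm D\varphi(t/v)\wedge\mathrm T\neg\varphi(t/v)))\big)$ - (R1) $\forall\varphi(v)\forall s\forall t(s^\circ=t^\circ\to(\mathrm T\varphi(s)\leftrightarrow\mathrm T\varphi(t)))$ - (R2) $\forall\varphi(v)\forall s\forall t(s^\circ=t^\circ\to(\mathrm D\varphi(s)\leftrightarrow\mathrm D\varphi(t)))$ **$\mathsf{CKF}_{\mathsf{cs}}$** is the $\mathcal L_{\mathrm T}$-theory consisting of $\mathsf{PA}$ with induction for all $\mathcal L_{\mathrm T}$-formulas, the axioms (T1), (T4), (T5), (T6), (R1) above, and: - (T7) $\forall s\forall t(\mathrm T\mathrm T(s=t)\leftrightarrow s^\circ=t^\circ)$ - (T8) $\forall s\forall t(\mathrm T\mathrm F(s=t)\leftrightarrow s^\circ\neq t^\circ)$ - (T9) $\forall\varphi(\mathrm T\mathrm T\varphi\leftrightarrow\mathrm T\mathrm T\neg\neg\varphi)$ - (T10) $\forall\varphi,\psi(\mathrm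 T\mathrm T(\varphi\wedge\psi)\leftrightarrow\mathrm T\mathrm T\varphi\wedge\mathrm T\mathrm T\psi)$ - (T11) $\forall\varphi,\psi(\mathrm T\mathrm F(\varphi\wedge\psi)\leftrightarrow\mathrm T\mathrm F\varphi\vee\mathrm T\mathrm F\psi)$ - (T12) $\forall\varphi(v)(\mathrm T\mathrm T(\forall v\varphi)\leftrightarrow\mathrm T(\forall t\,\mathrm T\varphi(t/v)))$ - (T13) $\forall\varphi(v)(\mathrm T\mathrm F(\forall v\varphi)\leftrightarrow\mathrm T(\exists t\,\mathrm F\varphi(t/v)))$ - (T14) $\forall t(\mathrm T\mathrm T\mathrm T t\leftrightarrow\mathrm T\mathrm T t)$ - (T15) $\forall t(\mathrm T\mathrm F\mathrm T t\leftrightarrow\mathrm T\mathrm F t)$ - (TDel) $\forall t(\mathrm T\mathrm T t\to\mathrm T t^\circ)$ In (T12), (T13), $\forall t\,\mathrm T\varphi(t/v)$ and $\exists t\,\mathrm F\varphi(t/v)$ under the outer $\mathrm T$ denote the code of the sentence ''for all closed terms $t$, $\mathrm T\varphi(t/v)$'', resp. ''for some closed term $t$, $\mathrm F\varphi(t/v)$''.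
   Formalization: Both theories are given the additional axiom that T holds only of (codes of) sentences; without it the listed axioms leave T open on non-sentences and the two theories differ, since CKF_cs then fails to prove (T3). *)

(* Defs.v *)
From Stdlib Require Import List Arith.
Import ListNotations.

(** * The language L_T

    De Bruijn syntax.  The function symbols are 0, S, +, * and, for the
    syntactic operations on codes,
    [s_num] n       : code of the n-th numeral,
    [s_eq] s t      : code of the equation between the terms coded by s and t,
    [s_tr] t        : code of the formula T(t),
    [s_neg], [s_and], [s_all] : codes of negation, conjunction, quantification,
    [s_sub] k x t   : code of the result of substituting the closed term coded
                      by t for the variable with index k in the expression
                      coded by x (indices above k are decremented). *)

Inductive fn1 := s_succ | s_num | s_tr | s_neg | s_all.
Inductive fn2 := s_plus | s_mult | s_eq | s_and.
Inductive fn3 := s_sub.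

Definition fn1s : list fn1 := [s_succ; s_num; s_tr; s_neg; s_all].
Definition fn2s : list fn2 := [s_plus; s_mult; s_eq; s_and].
Definition fn3s : list fn3 := [s_sub].

Inductive term :=
| Var (n : nat)
| Zero
| App1 (f : fn1) (t : term)
| App2 (f : fn2) (s t : term)
| App3 (f : fn3) (r s t : term).

Inductive form :=
| Equ (s t : term)
| Tru (t : term)
| Not (A : form)
| And (A B : form)
| All (A : form).

Definition Or A B := Not (And (Not A) (Not B)).
Definition Imp A B := Not (And A (Not B)).
Definition Iff A B := And (Imp A B) (Imp B A).
Definition Ex A := Not (All (Not A)).

Definition succ := App1 s_succ.
Definition num := App1 s_num.
Definition dtr := App1 s_tr.
Definition dneg := App1 s_neg.
Definition dall := App1 s_all.
Definition deq := App2 s_eq.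
Definition dand := App2 s_and.
Definition dsub := App3 s_sub.

Fixpoint numeral (n : nat) : term :=
  match n with 0 => Zero | S m => succ (numeral m) end.

Declare Scope fol_scope.
Delimit Scope fol_scope with fol.
Local Open Scope fol_scope.
Infix "≐" := Equ (at level 60) : fol_scope.
Infix "⊕" := (App2 s_plus) (at level 50, left associativity) : fol_scope.
Infix "⊗" := (App2 s_mult) (at level 40, left associativity) : fol_scope.
Notation "'¬' A" := (Not A) (at level 65, right associativity) : fol_scope.
Infix "⊓" := And (at level 70, right associativity) : fol_scope.
Infix "⊔" := Or (at level 75, right associativity) : fol_scope.
Infix "⟶" := Imp (at level 80, right associativity) : fol_scope.
Infix "⟷" := Iff (at level 85, no associativity) : fol_scope.

Definition disj (l : list form) : form := fold_right Or (Zero ≐ succ Zero) l.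

(** ** Substitution and free variables *)

Fixpoint subst_term (sigma : nat -> term) (t : term) : term :=
  match t with
  | Var n => sigma n
  | Zero => Zero
  | App1 f s => App1 f (subst_term sigma s)
  | App2 f s1 s2 => App2 f (subst_term sigma s1) (subst_term sigma s2)
  | App3 f s1 s2 s3 =>
      App3 f (subst_term sigma s1) (subst_term sigma s2) (subst_term sigma s3)
  end.

Definition lift (n : nat) : term -> term := subst_term (fun i => Var (n + i)).
Notation "t ↑ n" := (lift n t) (at level 30, n at level 0) : fol_scope.

Definition up (sigma : nat -> term) (n : nat) : term :=
  match n with 0 => Var 0 | S m => sigma m ↑ 1 end.

Fixpoint subst (sigma : nat -> term) (A : form) : form :=
  match A with
  | Equ s t => Equ (subst_term sigma s) (subst_term sigma t)
  | Tru t => Tru (subst_term sigma t)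
  | Not B => Not (subst sigma B)
  | And B C => And (subst sigma B) (subst sigma C)
  | All B => All (subst (up sigma) B)
  end.

Definition lift_form : form -> form := subst (fun i => Var (S i)).

Definition inst (t : term) : form -> form :=
  subst (fun n => match n with 0 => t | S m => Var m end).

Fixpoint term_below (n : nat) (t : term) : Prop :=
  match t with
  | Var i => i < n
  | Zero => True
  | App1 _ s => term_below n s
  | App2 _ s1 s2 => term_below n s1 /\ term_below n s2
  | App3 _ s1 s2 s3 => term_below n s1 /\ term_below n s2 /\ term_below n s3
  end.

Fixpoint form_below (n : nat) (A : form) : Prop :=
  match A with
  | Equ s t => term_below n s /\ term_below n t
  | Tru t => term_below n t
  | Not B => form_below n B
  | And B C => form_below n B /\ form_below n C
  | All B => form_below (S n) B
  end.

Definition sentence (A : form) : Prop := form_below 0 A.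

(** ** Provability: classical natural deduction with equality

    [Th] is meant to be a set of sentences, hence is not lifted in [d_allI]. *)

Inductive deriv (Th : form -> Prop) : list form -> form -> Prop :=
| d_ax G A : Th A -> deriv Th G A
| d_hyp G A : In A G -> deriv Th G A
| d_notI G A B : deriv Th (A :: G) B -> deriv Th (A :: G) (Not B) -> deriv Th G (Not A)
| d_notE G A B : deriv Th (Not A :: G) B -> deriv Th (Not A :: G) (Not B) -> deriv Th G A
| d_andI G A B : deriv Th G A -> deriv Th G B -> deriv Th G (And A B)
| d_andE1 G A B : deriv Th G (And A B) -> deriv Th G A
| d_andE2 G A B : deriv Th G (And A B) -> deriv Th G B
| d_allI G A : deriv Th (map lift_form G) A -> deriv Th G (All A)
| d_allE G A t : deriv Th G (All A) -> deriv Th G (inst t A)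
| d_refl G t : deriv Th G (Equ t t)
| d_repl G A s t : deriv Th G (Equ s t) -> deriv Th G (inst s A) -> deriv Th G (inst t A).

Definition proves (Th : form -> Prop) (A : form) : Prop := deriv Th [] A.

(** * Goedel numbering

    Based on the injection (x, y) |-> (x + y)^2 + x of pairs into numbers. *)

Definition pair (x y : nat) : nat := (x + y) * (x + y) + x.

Definition num1 (f : fn1) : nat :=
  match f with s_succ => 0 | s_num => 1 | s_tr => 2 | s_neg => 3 | s_all => 4 end.
Definition num2 (f : fn2) : nat :=
  match f with s_plus => 0 | s_mult => 1 | s_eq => 2 | s_and => 3 end.
Definition num3 (f : fn3) : nat := match f with s_sub => 0 end.

Fixpoint code_term (t : term) : nat :=
  match t with
  | Var n => pair 0 n
  | Zero => pair 1 0
  | App1 f s => pair 2 (pair (num1 f) (code_term s))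
  | App2 f s1 s2 => pair 3 (pair (num2 f) (pair (code_term s1) (code_term s2)))
  | App3 f s1 s2 s3 =>
      pair 4 (pair (num3 f) (pair (code_term s1) (pair (code_term s2) (code_term s3))))
  end.

Fixpoint code (A : form) : nat :=
  match A with
  | Equ s t => pair 5 (pair (code_term s) (code_term t))
  | Tru t => pair 6 (code_term t)
  | Not B => pair 7 (code B)
  | And B C => pair 8 (pair (code B) (code C))
  | All B => pair 9 (code B)
  end.

(** ** The same operations as terms of the language *)

Definition pr (s t : term) : term := (s ⊕ t) ⊗ (s ⊕ t) ⊕ s.

Definition cvar (i : term) : term := pr Zero i.
Definition czero : term := pr (numeral 1) Zero.
Definition cap1 (f s : term) : term := pr (numeral 2) (pr f s).
Definition cap2 (f s t : term) : term := pr (numeral 3) (pr f (pr s t)).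
Definition cap3 (f r s t : term) : term := pr (numeral 4) (pr f (pr r (pr s t))).

(** * Arithmetical definitions of the syntactic notions

    Parameters of a definition are lifted over the quantifiers it introduces. *)

Definition v (n : nat) : term := Var n.

Definition le s t := Ex (s↑1 ⊕ v 0 ≐ t↑1).
Definition lt s t := Ex (s↑1 ⊕ succ (v 0) ≐ t↑1).

(** Finite sets are coded by triples (b, c, d): the set consists of the x <= b
    such that 1 + (x + 1) d divides c. *)
Definition mem (x b c d : term) : form :=
  le x b ⊓ Ex (c↑1 ≐ v 0 ⊗ succ (succ (x↑1) ⊗ d↑1)).

(** The set whose components b, c, d are the variables n+2, n+1, n. *)
Definition inw (n : nat) (x : term) : form := mem x (v (n + 2)) (v (n + 1)) (v n).

(** x is (the code of) a term with all variable indices below k: x belongs to a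
    finite set each of whose members is such an atomic term or is obtained by a
    function symbol from members of the set. *)
Definition term_step (n : nat) (k u : term) : form :=
  Ex (lt (v 0) (k↑1) ⊓ u↑1 ≐ cvar (v 0))
  ⊔ u ≐ czero
  ⊔ disj (map (fun f => Ex (u↑1 ≐ cap1 (numeral (num1 f)) (v 0) ⊓ inw (n + 1) (v 0))) fn1s)
  ⊔ disj (map (fun f => Ex (Ex (u↑2 ≐ cap2 (numeral (num2 f)) (v 1) (v 0)
                                ⊓ inw (n + 2) (v 1) ⊓ inw (n + 2) (v 0)))) fn2s)
  ⊔ disj (map (fun f => Ex (Ex (Ex (u↑3 ≐ cap3 (numeral (num3 f)) (v 2) (v 1) (v 0)
                                ⊓ inw (n + 3) (v 2) ⊓ inw (n + 3) (v 1)
                                ⊓ inw (n + 3) (v 0))))) fn3s).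

Definition isTerm (k x : term) : form :=
  Ex (Ex (Ex (inw 0 (x↑3) ⊓ All (inw 1 (v 0) ⟶ term_step 1 (k↑4) (v 0))))).

(** x is a formula with all free indices below k: the finite set contains pairs
    (j, u) with u a formula with all free indices below j. *)
Definition form_step (n : nat) (j u : term) : form :=
  Ex (Ex (u↑2 ≐ deq (v 1) (v 0) ⊓ isTerm (j↑2) (v 1) ⊓ isTerm (j↑2) (v 0)))
  ⊔ Ex (u↑1 ≐ dtr (v 0) ⊓ isTerm (j↑1) (v 0))
  ⊔ Ex (u↑1 ≐ dneg (v 0) ⊓ inw (n + 1) (pr (j↑1) (v 0)))
  ⊔ Ex (Ex (u↑2 ≐ dand (v 1) (v 0)
            ⊓ inw (n + 2) (pr (j↑2) (v 1)) ⊓ inw (n + 2) (pr (j↑2) (v 0))))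
  ⊔ Ex (u↑1 ≐ dall (v 0) ⊓ inw (n + 1) (pr (succ (j↑1)) (v 0))).

Definition isForm (k x : term) : form :=
  Ex (Ex (Ex (inw 0 (pr (k↑3) (x↑3))
              ⊓ All (All (inw 2 (pr (v 1) (v 0)) ⟶ form_step 2 (v 1) (v 0)))))).

Definition isCterm (x : term) : form := isTerm Zero x.
Definition isSent (x : term) : form := isForm Zero x.
(** Formulas "phi(v)"; the variable v is the one with index 0. *)
Definition isForm1 (x : term) : form := isForm (numeral 1) x.

(** y is the value of the closed term x. *)
Definition val_step (n : nat) (u y : term) : form :=
  (u ≐ czero ⊓ y ≐ Zero)
  ⊔ disj (map (fun f => Ex (Ex (u↑2 ≐ cap1 (numeral (num1 f)) (v 1)
            ⊓ inw (n + 2) (pr (v 1) (v 0))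
            ⊓ y↑2 ≐ App1 f (v 0)))) fn1s)
  ⊔ disj (map (fun f => Ex (Ex (Ex (Ex (u↑4 ≐ cap2 (numeral (num2 f)) (v 3) (v 2)
            ⊓ inw (n + 4) (pr (v 3) (v 1)) ⊓ inw (n + 4) (pr (v 2) (v 0))
            ⊓ y↑4 ≐ App2 f (v 1) (v 0)))))) fn2s)
  ⊔ disj (map (fun f => Ex (Ex (Ex (Ex (Ex (Ex (
            u↑6 ≐ cap3 (numeral (num3 f)) (v 5) (v 4) (v 3)
            ⊓ inw (n + 6) (pr (v 5) (v 2)) ⊓ inw (n + 6) (pr (v 4) (v 1))
            ⊓ inw (n + 6) (pr (v 3) (v 0))
            ⊓ y↑6 ≐ App3 f (v 2) (v 1) (v 0)))))))) fn3s).

Definition isVal (x y : term) : form :=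
  Ex (Ex (Ex (inw 0 (pr (x↑3) (y↑3))
              ⊓ All (All (inw 2 (pr (v 1) (v 0)) ⟶ val_step 2 (v 1) (v 0)))))).

(** Guarded quantifiers: closed terms, sentences, formulas phi(v). *)
Definition AllC A := All (isCterm (v 0) ⟶ A).
Definition ExC A := Ex (isCterm (v 0) ⊓ A).
Definition AllS A := All (isSent (v 0) ⟶ A).
Definition AllF A := All (isForm1 (v 0) ⟶ A).

(** s° = t° *)
Definition eqval (s t : term) : form := Ex (isVal (s↑1) (v 0) ⊓ isVal (t↑1) (v 0)).

(** [dat A t]: code of A(t), for A with at most the variable 0 free and t (the
    code of) a closed term. *)
Definition dat (A : form) (t : term) : term := dsub Zero (numeral (code A)) t.

(** x(t/v), for x (the code of) a formula phi(v). *)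
Definition at_ (x t : term) : term := dsub Zero x t.

(** * PA in L_T *)

Definition arith_axioms : list form :=
  [ All (¬ succ (v 0) ≐ Zero);
    All (All (succ (v 1) ≐ succ (v 0) ⟶ v 1 ≐ v 0));
    All (v 0 ⊕ Zero ≐ v 0);
    All (All (v 1 ⊕ succ (v 0) ≐ succ (v 1 ⊕ v 0)));
    All (v 0 ⊗ Zero ≐ Zero);
    All (All (v 1 ⊗ succ (v 0) ≐ v 1 ⊗ v 0 ⊕ v 1)) ].

(** x is of one of the shapes in the recursion for substitution. *)
Definition is_node (x : term) : form :=
  Ex (x↑1 ≐ cvar (v 0))
  ⊔ x ≐ czero
  ⊔ Ex (Ex (x↑2 ≐ cap1 (v 1) (v 0)))
  ⊔ Ex (Ex (Ex (x↑3 ≐ cap2 (v 2) (v 1) (v 0))))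
  ⊔ Ex (Ex (Ex (Ex (x↑4 ≐ cap3 (v 3) (v 2) (v 1) (v 0)))))
  ⊔ Ex (Ex (x↑2 ≐ deq (v 1) (v 0)))
  ⊔ Ex (x↑1 ≐ dtr (v 0))
  ⊔ Ex (x↑1 ≐ dneg (v 0))
  ⊔ Ex (Ex (x↑2 ≐ dand (v 1) (v 0)))
  ⊔ Ex (x↑1 ≐ dall (v 0)).

(** Defining equations of the syntactic function symbols. *)
Definition syntax_axioms : list form :=
  [ All (All (deq (v 1) (v 0) ≐ pr (numeral 5) (pr (v 1) (v 0))));
    All (dtr (v 0) ≐ pr (numeral 6) (v 0));
    All (dneg (v 0) ≐ pr (numeral 7) (v 0));
    All (All (dand (v 1) (v 0) ≐ pr (numeral 8) (pr (v 1) (v 0))));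
    All (dall (v 0) ≐ pr (numeral 9) (v 0));
    num Zero ≐ czero;
    All (num (succ (v 0)) ≐ cap1 (numeral (num1 s_succ)) (num (v 0)));
    (* substitution: v 1 is the index, v 0 the substituted term *)
    All (All (All (lt (v 0) (v 2) ⟶ dsub (v 2) (cvar (v 0)) (v 1) ≐ cvar (v 0))));
    All (All (dsub (v 1) (cvar (v 1)) (v 0) ≐ v 0));
    All (All (All (le (v 2) (v 0) ⟶ dsub (v 2) (cvar (succ (v 0))) (v 1) ≐ cvar (v 0))));
    All (All (dsub (v 1) czero (v 0) ≐ czero));
    All (All (All (All (dsub (v 1) (cap1 (v 3) (v 2)) (v 0)
      ≐ cap1 (v 3) (dsub (v 1) (v 2) (v 0))))));
    All (All (All (All (All (dsub (v 1) (cap2 (v 4) (v 3) (v 2)) (v 0)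
      ≐ cap2 (v 4) (dsub (v 1) (v 3) (v 0)) (dsub (v 1) (v 2) (v 0)))))));
    All (All (All (All (All (All (dsub (v 1) (cap3 (v 5) (v 4) (v 3) (v 2)) (v 0)
      ≐ cap3 (v 5) (dsub (v 1) (v 4) (v 0)) (dsub (v 1) (v 3) (v 0))
          (dsub (v 1) (v 2) (v 0))))))));
    All (All (All (All (dsub (v 1) (deq (v 3) (v 2)) (v 0)
      ≐ deq (dsub (v 1) (v 3) (v 0)) (dsub (v 1) (v 2) (v 0))))));
    All (All (All (dsub (v 1) (dtr (v 2)) (v 0) ≐ dtr (dsub (v 1) (v 2) (v 0)))));
    All (All (All (dsub (v 1) (dneg (v 2)) (v 0) ≐ dneg (dsub (v 1) (v 2) (v 0)))));
    All (All (All (All (dsub (v 1) (dand (v 3) (v 2)) (v 0)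
      ≐ dand (dsub (v 1) (v 3) (v 0)) (dsub (v 1) (v 2) (v 0))))));
    All (All (All (dsub (v 1) (dall (v 2)) (v 0)
      ≐ dall (dsub (succ (v 1)) (v 2) (v 0)))));
    All (All (All (¬ is_node (v 2) ⟶ dsub (v 1) (v 2) (v 0) ≐ v 2))) ].

Definition induction (A : form) : form :=
  inst Zero A
  ⊓ All (A ⟶ subst (fun n => match n with 0 => succ (v 0) | S m => v (S m) end) A)
  ⟶ All A.

Fixpoint foralls (n : nat) (A : form) : form :=
  match n with 0 => A | S m => All (foralls m A) end.

Definition PA (A : form) : Prop :=
  In A arith_axioms \/ In A syntax_axioms \/
  exists n B, form_below n (induction B) /\ A = foralls n (induction B).

(** * Truth and determinateness

    For terms x, t: [TT x] is TTx, i.e. T of the code of T(num(x)), whereas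
    [TTc t] is T of the code of T(t) for t (the code of) a closed term;
    similarly for TF and D. *)

Definition Fls (t : term) : form := Tru (dneg t).

Definition dF (t : term) : term := dat (Fls (v 0)) t.
Definition TTc (t : term) : form := Tru (dtr t).
Definition TFc (t : term) : form := Tru (dF t).
Definition TT (x : term) : form := TTc (num x).
Definition TF (x : term) : form := TFc (num x).

Definition D (x : term) : form := TT x ⊔ TF x.
Definition dD (t : term) : term := dat (D (v 0)) t.

(** T t° and D t° *)
Definition Tval (t : term) : form := Ex (isVal (t↑1) (v 0) ⊓ Tru (v 0)).
Definition Dval (t : term) : form := Ex (isVal (t↑1) (v 0) ⊓ D (v 0)).

(** Truth is a predicate of sentences.  T4 controls negation on sentences only,
    while T3 and T15 speak about all closed terms.  Without this axiom there may
    be a non-sentence n with TFn, and the two theories disagree about it: T3 can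
    fail in CKFcs (if Tn and not TTn) and T15 can fail in CDT (if Tn and TTn). *)
Definition Tsent : form := All (Tru (v 0) ⟶ isSent (v 0)).

Definition T1 := AllC (AllC (Tru (deq (v 1) (v 0)) ⟷ eqval (v 1) (v 0))).
Definition T2p := AllC (Dval (v 0) ⟷ Tru (dD (v 0))).
Definition T3 := AllC (Dval (v 0) ⟶ (TTc (v 0) ⟷ Tval (v 0))).
Definition T4 := AllS (Tru (dneg (v 0)) ⟷ ¬ Tru (v 0)).
Definition T5 := AllS (AllS (Tru (dand (v 1) (v 0)) ⟷ Tru (v 1) ⊓ Tru (v 0))).
Definition T6 := AllF (Tru (dall (v 0)) ⟷ AllC (Tru (at_ (v 1) (v 0)))).

Definition D1 := AllC (AllC (D (deq (v 1) (v 0)))).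
Definition D2 := AllC (D (dtr (v 0)) ⟷ Dval (v 0)).
Definition D3 := AllC (D (dD (v 0)) ⟷ Dval (v 0)).
Definition D4 := AllS (D (dneg (v 0)) ⟷ D (v 0)).
Definition D5 := AllS (AllS (D (dand (v 1) (v 0)) ⟷
  ((D (v 1) ⊓ D (v 0)) ⊔ (D (v 1) ⊓ Tru (dneg (v 1))) ⊔ (D (v 0) ⊓ Tru (dneg (v 0)))))).
Definition D6 := AllF (D (dall (v 0)) ⟷
  (AllC (D (at_ (v 1) (v 0)))
   ⊔ ExC (D (at_ (v 1) (v 0)) ⊓ Tru (dneg (at_ (v 1) (v 0)))))).

Definition R1 := AllF (AllC (AllC (eqval (v 1) (v 0) ⟶
  (Tru (at_ (v 2) (v 1)) ⟷ Tru (at_ (v 2) (v 0)))))).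
Definition R2 := AllF (AllC (AllC (eqval (v 1) (v 0) ⟶
  (D (at_ (v 2) (v 1)) ⟷ D (at_ (v 2) (v 0)))))).

Definition T7 := AllC (AllC (TT (deq (v 1) (v 0)) ⟷ eqval (v 1) (v 0))).
Definition T8 := AllC (AllC (TF (deq (v 1) (v 0)) ⟷ ¬ eqval (v 1) (v 0))).
Definition T9 := AllS (TT (v 0) ⟷ TT (dneg (dneg (v 0)))).
Definition T10 := AllS (AllS (TT (dand (v 1) (v 0)) ⟷ TT (v 1) ⊓ TT (v 0))).
Definition T11 := AllS (AllS (TF (dand (v 1) (v 0)) ⟷ TF (v 1) ⊔ TF (v 0))).
(** Under the outer T, the variable 0 of the formula given to [dat] stands for
    the numeral of phi. *)
Definition T12 := AllF (TT (dall (v 0)) ⟷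
  Tru (dat (AllC (Tru (at_ (v 1) (v 0)))) (num (v 0)))).
Definition T13 := AllF (TF (dall (v 0)) ⟷
  Tru (dat (ExC (Fls (at_ (v 1) (v 0)))) (num (v 0)))).
Definition T14 := AllC (TT (dtr (v 0)) ⟷ TTc (v 0)).
Definition T15 := AllC (TF (dtr (v 0)) ⟷ TFc (v 0)).
Definition TDel := AllC (TTc (v 0) ⟶ Tval (v 0)).

Definition CDT (A : form) : Prop :=
  PA A \/ A = Tsent \/
  In A [T1; T2p; T3; T4; T5; T6; D1; D2; D3; D4; D5; D6; R1; R2].

Definition CKFcs (A : form) : Prop :=
  PA A \/ A = Tsent \/
  In A [T1; T4; T5; T6; R1; T7; T8; T9; T10; T11; T12; T13; T14; T15; TDel].

(* Main.v *)
From Stdlib Require Import List Arith Lia Ring.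
From Stdlib Require Import Classical ClassicalEpsilon FunctionalExtensionality PropExtensionality.
Require Import Defs.
Import ListNotations.
Local Open Scope fol_scope.

(** By the completeness theorem ([completeness]) it suffices to show that every
    model of one theory satisfies the axioms of the other, so the argument takes
    place in an arbitrary model M of the common part of the two theories: PA with
    full induction, T1, T4, T5, T6, R1, and the axiom that only sentences are true.

    Write tau x for the truth in M of the sentence T(num x).  R1 implies that the
    truth of T(t) depends only on the value of t.  Together with T1, T4, T5, T6
    this shows, by induction on a standard formula A, that A(t1, ..., tn) is true
    in the sense of M if and only if A holds of the values of the ti in the
    structure that arises from M when T is interpreted by tau ([truth]).  Every
    axiom in which T is applied to the code of a defined formula, like T2p, D3, T12
    and T13, is thereby turned into a statement about tau ([KF] and [CD]).  For
    instance TF x is tau of the negation of x, and T12 says that tau commutes with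
    the universal quantifier over closed terms.

    What remains is short.  Given [CD], inner truth and truth agree on determinate
    sentences, so each of T7 to T15 follows from the corresponding determinateness
    axiom and the classical clause for T ([CD_KF]).  Given [KF], the clauses of
    CD are read off from the strong Kleene clauses for tau; consistency of tau
    comes from TDel and T4 ([KF_CD]).  Only R2 needs an induction on the formula
    in question: the instances of a universal formula may have larger codes, so
    the induction is on logical complexity ([kf_reg]).

    All of this presupposes the elementary theory of syntax in M, where terms and
    formulas may be nonstandard: existence of finite sets
    ([comprehension]), induction on terms and formulas ([term_ind], [form_ind]),
    existence and uniqueness of values ([IsVal_total], [IsVal_functional]) and
    commutation of substitutions ([SUB_SUB_form]). *)

Definition scons {X : Type} (x : X) (rho : nat -> X) (n : nat) : X :=
  match n with 0 => x | S m => rho m end.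
Notation "x .: rho" := (scons x rho) (at level 55, right associativity).

(** * Substitution *)

Lemma inst_scons t A : inst t A = subst (t .: Var) A.
Proof. reflexivity. Qed.

Lemma subst_term_comp tau sigma t :
  subst_term tau (subst_term sigma t) = subst_term (fun n => subst_term tau (sigma n)) t.
Proof. induction t; cbn; congruence. Qed.

Lemma subst_term_id t : subst_term Var t = t.
Proof. induction t; cbn; congruence. Qed.

Lemma up_comp tau sigma :
  (fun n => subst_term (up tau) (up sigma n)) = up (fun n => subst_term tau (sigma n)).
Proof.
  extensionality n. destruct n; cbn; [reflexivity|].
  unfold lift. rewrite !subst_term_comp. reflexivity.
Qed.

Lemma subst_comp A : forall tau sigma,
  subst tau (subst sigma A) = subst (fun n => subst_term tau (sigma n)) A.
Proof.
  induction A; intros tau sigma; cbn;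
    rewrite ?subst_term_comp, ?IHA, ?IHA1, ?IHA2, <- ?up_comp; reflexivity.
Qed.

Lemma up_Var : up Var = Var.
Proof. extensionality n. destruct n; reflexivity. Qed.

Lemma subst_id A : subst Var A = A.
Proof. induction A; cbn; rewrite ?subst_term_id, ?up_Var; congruence. Qed.

Lemma subst_term_below n t sigma tau : term_below n t ->
  (forall i, i < n -> sigma i = tau i) -> subst_term sigma t = subst_term tau t.
Proof.
  intros Ht H. induction t; cbn in *; auto; f_equal; tauto.
Qed.

Lemma subst_below A : forall n sigma tau, form_below n A ->
  (forall i, i < n -> sigma i = tau i) -> subst sigma A = subst tau A.
Proof.
  induction A; cbn; intros n sigma tau HA H; try (f_equal; now eauto using subst_term_below).
  - destruct HA. f_equal; eauto using subst_term_below.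
  - destruct HA. f_equal; eauto.
  - f_equal. apply (IHA (S n)); [exact HA|].
    intros [|i] Hi; cbn; [reflexivity|]. rewrite H by lia. reflexivity.
Qed.

Lemma subst_sentence A sigma : sentence A -> subst sigma A = A.
Proof.
  intros HA. rewrite <- (subst_id A) at 2. eapply subst_below; [exact HA|]. intros i Hi. inversion Hi.
Qed.

Lemma lift_form_subst sigma A : lift_form (subst sigma A) = subst (up sigma) (lift_form A).
Proof. unfold lift_form. rewrite !subst_comp. reflexivity. Qed.

Lemma subst_inst sigma t A :
  subst sigma (inst t A) = inst (subst_term sigma t) (subst (up sigma) A).
Proof.
  rewrite !inst_scons, !subst_comp. f_equal. extensionality n. destruct n; cbn; [reflexivity|].
  unfold lift. rewrite subst_term_comp. symmetry. apply subst_term_id.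
Qed.

Lemma term_below_mono n m t : n <= m -> term_below n t -> term_below m t.
Proof. intros H. induction t; cbn; try tauto. lia. Qed.

Lemma form_below_mono A : forall n m, n <= m -> form_below n A -> form_below m A.
Proof.
  induction A; cbn; intros n m H.
  - intros []; split; eauto using term_below_mono.
  - eauto using term_below_mono.
  - eauto.
  - intros []; split; eauto.
  - apply IHA. lia.
Qed.

Lemma term_below_ex t : exists n, term_below n t.
Proof.
  induction t as [i| |f t [n H]|f t1 [n1 H1] t2 [n2 H2]|f t1 [n1 H1] t2 [n2 H2] t3 [n3 H3]]; cbn.
  - exists (S i). lia.
  - now exists 0.
  - eauto.
  - exists (n1 + n2). split; (eapply term_below_mono; [|eassumption]); lia.
  - exists (n1 + n2 + n3). repeat split; (eapply term_below_mono; [|eassumption]); lia.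
Qed.

Lemma form_below_ex A : exists n, form_below n A.
Proof.
  induction A as [s t|t|A [n H]|A [n H] B [m K]|A [n H]]; cbn.
  - destruct (term_below_ex s) as [n H], (term_below_ex t) as [m K].
    exists (n + m). split; (eapply term_below_mono; [|eassumption]); lia.
  - apply term_below_ex.
  - eauto.
  - exists (n + m). split; (eapply form_below_mono; [|eassumption]); lia.
  - exists n. eapply form_below_mono; [|eassumption]. lia.
Qed.

Lemma ctx_below_ex G : exists n, forall A, In A G -> form_below n A.
Proof.
  induction G as [|A G [n H]].
  - exists 0. intros A [].
  - destruct (form_below_ex A) as [m K]. exists (n + m).
    intros B [<-|HB]; (eapply form_below_mono; [|eauto]); lia.
Qed.

Lemma term_below_subst n m sigma t : term_below n t ->
  (forall i, i < n -> term_below m (sigma i)) -> term_below m (subst_term sigma t).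
Proof. intros Ht H. induction t; cbn in *; auto; intuition. Qed.

(** * Derivations *)

Lemma deriv_weaken Th G A : deriv Th G A -> forall G', incl G G' -> deriv Th G' A.
Proof.
  induction 1; intros G' HG.
  - now apply d_ax.
  - apply d_hyp. auto.
  - apply d_notI with B; [apply IHderiv1|apply IHderiv2]; intros C [<-|HC]; cbn; auto.
  - apply d_notE with B; [apply IHderiv1|apply IHderiv2]; intros C [<-|HC]; cbn; auto.
  - apply d_andI; auto.
  - apply d_andE1 with B; auto.
  - apply d_andE2 with A; auto.
  - apply d_allI. apply IHderiv. now apply incl_map.
  - apply d_allE. auto.
  - apply d_refl.
  - apply d_repl with s; auto.
Qed.

Lemma deriv_cut_theory Th Th' G A :
  (forall B, Th B -> proves Th' B) -> deriv Th G A -> deriv Th' G A.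
Proof.
  intros HTh. induction 1.
  - apply deriv_weaken with []; [now apply HTh | intros B []].
  - now apply d_hyp.
  - now apply d_notI with B.
  - now apply d_notE with B.
  - now apply d_andI.
  - now apply d_andE1 with B.
  - now apply d_andE2 with A.
  - now apply d_allI.
  - now apply d_allE.
  - apply d_refl.
  - now apply d_repl with s.
Qed.

Lemma deriv_subst Th (HTh : forall A, Th A -> sentence A) G A : deriv Th G A ->
  forall sigma, deriv Th (map (subst sigma) G) (subst sigma A).
Proof.
  induction 1; intros sigma; cbn in *.
  - rewrite subst_sentence by auto. now apply d_ax.
  - apply d_hyp. now apply in_map.
  - apply d_notI with (subst sigma B); [apply IHderiv1|apply (IHderiv2 sigma)].
  - apply d_notE with (subst sigma B); [apply IHderiv1|apply (IHderiv2 sigma)].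
  - apply d_andI; auto.
  - eapply d_andE1. apply IHderiv.
  - eapply d_andE2. apply IHderiv.
  - apply d_allI. specialize (IHderiv (up sigma)). rewrite map_map in *.
    erewrite map_ext; [exact IHderiv|]. intros B. apply lift_form_subst.
  - rewrite subst_inst. apply d_allE. apply IHderiv.
  - apply d_refl.
  - rewrite subst_inst. apply d_repl with (subst_term sigma s); [apply IHderiv1|].
    rewrite <- subst_inst. apply IHderiv2.
Qed.

(** A variable [m] that does not occur in the context serves as an eigenvariable. *)
Lemma deriv_fresh Th (HTh : forall A, Th A -> sentence A) G A m :
  (forall B, In B G -> form_below m B) -> form_below (S m) A ->
  deriv Th G (inst (Var m) A) -> deriv Th G (All A).
Proof.
  intros HG HA H. apply d_allI.
  (* the renaming that sends m to 0 and every other i to i + 1 *)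
  set (sigma := fun i => if Nat.eq_dec i m then Var 0 else Var (S i)).
  apply deriv_subst with (sigma := sigma) in H; [|exact HTh].
  assert (E : subst sigma (inst (Var m) A) = A).
  { rewrite inst_scons, subst_comp. rewrite <- (subst_id A) at 2.
    eapply subst_below; [exact HA|]. intros [|i] Hi; cbn; unfold sigma.
    - destruct (Nat.eq_dec m m); congruence.
    - destruct (Nat.eq_dec i m); [lia | reflexivity]. }
  rewrite E in H. erewrite map_ext_in; [exact H|].
  intros B HB. eapply subst_below; [exact (HG B HB)|].
  intros i Hi. unfold sigma. destruct (Nat.eq_dec i m); [lia | reflexivity].
Qed.

(** * Structures *)

(** The interpretation of T is kept apart from the rest of a structure, because
    one and the same arithmetical part is considered with two of them. *)
Record struct := {
  dom :> Type;
  i0 : dom;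
  i1 : fn1 -> dom -> dom;
  i2 : fn2 -> dom -> dom -> dom;
  i3 : fn3 -> dom -> dom -> dom -> dom }.

Fixpoint eval (M : struct) (rho : nat -> M) (t : term) : M :=
  match t with
  | Var n => rho n
  | Zero => i0 M
  | App1 f s => i1 M f (eval M rho s)
  | App2 f s1 s2 => i2 M f (eval M rho s1) (eval M rho s2)
  | App3 f s1 s2 s3 => i3 M f (eval M rho s1) (eval M rho s2) (eval M rho s3)
  end.

Fixpoint sat (M : struct) (Tr : M -> Prop) (rho : nat -> M) (A : form) : Prop :=
  match A with
  | Equ s t => eval M rho s = eval M rho t
  | Tru t => Tr (eval M rho t)
  | Not B => ~ sat M Tr rho B
  | And B C => sat M Tr rho B /\ sat M Tr rho C
  | All B => forall x, sat M Tr (x .: rho) B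
  end.

Definition model (M : struct) (Tr : M -> Prop) (Th : form -> Prop) : Prop :=
  forall A, Th A -> forall rho, sat M Tr rho A.

(** * Completeness *)

(** The Henkin construction, with the variables of the language as witnesses:
    as the axioms are sentences, only finitely many variables are in use at each
    stage. *)

Section Henkin.
  Context (Th : form -> Prop) (HTh : forall A, Th A -> sentence A).

  Definition consistent (G : list form) : Prop :=
    ~ exists B, deriv Th G B /\ deriv Th G (Not B).

  Lemma inconsistent_Not G A : ~ consistent (Not A :: G) -> deriv Th G A.
  Proof.
    intros H. apply NNPP in H. destruct H as [B [H1 H2]]. now apply d_notE with B.
  Qed.

  Lemma inconsistent_pos G A : ~ consistent (A :: G) -> deriv Th G (Not A).
  Proof.
    intros H. apply NNPP in H. destruct H as [B [H1 H2]]. now apply d_notI with B.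
  Qed.

  Lemma consistent_incl G G' : incl G G' -> consistent G' -> consistent G.
  Proof.
    intros HG HC [B [H1 H2]]. apply HC. exists B. split; eapply deriv_weaken; eauto.
  Qed.

  Lemma deriv_cut G A B : deriv Th G A -> deriv Th (A :: G) B -> deriv Th G B.
  Proof.
    intros HA HB. apply d_notE with B.
    - apply d_notE with A.
      + eapply deriv_weaken; [exact HA|]. intros C HC. cbn. auto.
      + apply d_notI with B.
        * eapply deriv_weaken; [exact HB|]. intros C [<-|HC]; cbn; auto.
        * apply d_hyp. cbn. auto.
    - apply d_hyp. cbn. auto.
  Qed.

  Lemma consistent_cut G A : deriv Th G A -> consistent G -> consistent (A :: G).
  Proof.
    intros HA HC [B [H1 H2]]. apply HC. exists B. split; eapply deriv_cut; eauto.
  Qed.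

  (** If no variable could serve as a witness, then a fresh one could be generalized. *)
  Lemma consistent_witness G A : consistent (Not (All A) :: G) ->
    exists m, consistent (Not (inst (Var m) A) :: Not (All A) :: G).
  Proof.
    intros HC. destruct (ctx_below_ex (Not (All A) :: G)) as [m Hm].
    exists m. intros Hinc. apply HC. exists (All A). split; [|apply d_hyp; cbn; auto].
    apply deriv_fresh with m; [exact HTh | exact Hm | | ].
    - apply (Hm (Not (All A))). cbn. auto.
    - apply inconsistent_Not. auto.
  Qed.

  (** One step of the construction: [A] is added if that is consistent, together
      with a witness if [A] is a negated universal formula. *)
  Lemma extend_ex G A : exists G', incl G G' /\ (consistent G -> consistent G') /\
    (consistent (A :: G) ->
      In A G' /\ forall B, A = Not (All B) -> exists m, In (Not (inst (Var m) B)) G').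
  Proof.
    destruct (classic (consistent (A :: G))) as [HC|HC].
    2: { exists G. split; [apply incl_refl|]. tauto. }
    destruct (classic (exists B, A = Not (All B))) as [[B ->]|HB].
    - destruct (consistent_witness G B HC) as [m Hm].
      exists (Not (inst (Var m) B) :: Not (All B) :: G).
      split; [intros C; cbn; auto|]. split; [auto|]. intros _. split; [cbn; auto|].
      intros B' [= <-]. exists m. cbn. auto.
    - exists (A :: G). split; [intros C; cbn; auto|]. split; [auto|].
      intros _. split; [cbn; auto|]. intros B ->. exfalso. eauto.
  Qed.

  Definition extend (G : list form) (A : form) : list form :=
    proj1_sig (constructive_indefinite_description _ (extend_ex G A)).

  Lemma extend_spec G A : incl G (extend G A) /\ (consistent G -> consistent (extend G A)) /\
    (consistent (A :: G) -> In A (extend G A) /\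
      forall B, A = Not (All B) -> exists m, In (Not (inst (Var m) B)) (extend G A)).
  Proof. exact (proj2_sig (constructive_indefinite_description _ (extend_ex G A))). Qed.

  Context (enum : nat -> form) (enum_sur : forall A, exists n, enum n = A).
  Context (G0 : list form) (HG0 : consistent G0).

  Fixpoint stage (n : nat) : list form :=
    match n with 0 => G0 | S m => extend (stage m) (enum m) end.

  Lemma stage_consistent n : consistent (stage n).
  Proof. induction n; cbn; [exact HG0|]. now apply extend_spec. Qed.

  Lemma stage_incl n m : n <= m -> incl (stage n) (stage m).
  Proof.
    induction 1; [apply incl_refl|]. cbn. eapply incl_tran; [exact IHle|]. apply extend_spec.
  Qed.

  Definition limit (A : form) : Prop := exists n, deriv Th (stage n) A.

  Lemma limit_mono n m A : n <= m -> deriv Th (stage n) A -> deriv Th (stage m) A.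
  Proof. intros Hnm HA. eapply deriv_weaken; [exact HA|]. now apply stage_incl. Qed.

  Lemma limit_lift2 A B C : (forall G, deriv Th G A -> deriv Th G B -> deriv Th G C) ->
    limit A -> limit B -> limit C.
  Proof.
    intros Hr [n HA] [m HB]. exists (n + m).
    apply Hr; [apply limit_mono with n | apply limit_mono with m]; auto; lia.
  Qed.

  Lemma limit_consistent A : limit A -> limit (Not A) -> False.
  Proof.
    intros [n HA] [m HB]. apply (stage_consistent (n + m)). exists A.
    split; [apply limit_mono with n | apply limit_mono with m]; auto; lia.
  Qed.

  Lemma limit_complete A : limit A \/ limit (Not A).
  Proof.
    destruct (enum_sur A) as [n Hn].
    destruct (classic (consistent (A :: stage n))) as [HC|HC].
    - left. exists (S n). apply d_hyp. cbn. rewrite Hn. now apply extend_spec.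
    - right. exists n. now apply inconsistent_pos.
  Qed.

  Lemma limit_Not A : limit (Not A) <-> ~ limit A.
  Proof.
    split; [intros H1 H2; eauto using limit_consistent|].
    intros HA. destruct (limit_complete A); tauto.
  Qed.

  Lemma limit_And A B : limit (And A B) <-> limit A /\ limit B.
  Proof.
    split.
    - intros [n Hn]. split; exists n; [eapply d_andE1|eapply d_andE2]; eauto.
    - intros [HA HB]. revert HA HB. apply limit_lift2. intros; now apply d_andI.
  Qed.

  Lemma limit_All A : limit (All A) <-> forall t, limit (inst t A).
  Proof.
    split.
    - intros [n Hn] t. exists n. now apply d_allE.
    - intros HA. destruct (limit_complete (All A)) as [?|Hn]; [assumption|exfalso].
      destruct (enum_sur (Not (All A))) as [n En]. destruct Hn as [k Hk].
      assert (HC : consistent (Not (All A) :: stage n)).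
      { apply consistent_incl with (Not (All A) :: stage (n + k)).
        - intros C [<-|HC]; cbn; auto. right. revert C HC. apply stage_incl. lia.
        - apply consistent_cut; [|apply stage_consistent]. apply limit_mono with k; auto. lia. }
      rewrite <- En in HC. apply extend_spec in HC as [_ HC].
      destruct (HC A En) as [m Hm]. apply (limit_consistent (inst (Var m) A)); [apply HA|].
      exists (S n). apply d_hyp. exact Hm.
  Qed.

  Lemma limit_refl t : limit (Equ t t).
  Proof. exists 0. apply d_refl. Qed.

  Lemma limit_repl s t A : limit (Equ s t) -> limit (inst s A) -> limit (inst t A).
  Proof. apply limit_lift2. intros G. apply d_repl. Qed.

  Lemma subst_shift1 t s : subst_term (t .: Var) (s ↑ 1) = s.
  Proof. unfold lift. rewrite subst_term_comp. apply subst_term_id. Qed.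

  Lemma limit_sym s t : limit (Equ s t) -> limit (Equ t s).
  Proof.
    intros E. pose proof (limit_repl s t (Equ (Var 0) (s ↑ 1)) E) as K.
    rewrite !inst_scons in K. cbn [subst subst_term] in K.
    rewrite !subst_shift1 in K. apply K. apply limit_refl.
  Qed.

  Lemma limit_trans s t u : limit (Equ s t) -> limit (Equ t u) -> limit (Equ s u).
  Proof.
    intros E1 E2. pose proof (limit_repl t u (Equ (s ↑ 1) (Var 0)) E2) as K.
    rewrite !inst_scons in K. cbn [subst subst_term] in K.
    rewrite !subst_shift1 in K. now apply K.
  Qed.

  (** The term [u] is the context in which the argument of [f] is replaced, with
      variable 0 marking its place. *)
  Lemma limit_cong (f : term -> term) s t :
    (exists u, forall r, f r = subst_term (r .: Var) u) ->
    limit (Equ s t) -> limit (Equ (f s) (f t)).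
  Proof.
    intros [u Hu] E. pose proof (limit_repl s t (Equ ((f s) ↑ 1) u) E) as K.
    rewrite !inst_scons in K. cbn [subst] in K.
    rewrite !subst_shift1, <- !Hu in K. apply K. apply limit_refl.
  Qed.

  (** The carrier of the term model: equivalence classes of provably equal terms. *)
  Definition cls (t : term) : term -> Prop := fun s => limit (Equ s t).
  Definition carrier : Type := {c : term -> Prop | exists t, c = cls t}.
  Definition mk (t : term) : carrier := exist _ (cls t) (ex_intro _ t eq_refl).

  Lemma mk_eq s t : mk s = mk t <-> limit (Equ s t).
  Proof.
    split.
    - intros E. apply (f_equal (@proj1_sig _ _)) in E. cbn in E.
      change (cls t s). rewrite <- E. apply limit_refl.
    - intros E. apply eq_sig_hprop; [intros; apply proof_irrelevance|]. cbn.
      extensionality u. apply propositional_extensionality. unfold cls.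
      split; intros K; eapply limit_trans; eauto using limit_sym.
  Qed.

  Lemma mk_surj (c : carrier) : exists t, c = mk t.
  Proof.
    destruct c as [c [t ->]]. exists t. apply eq_sig_hprop; [intros; apply proof_irrelevance|].
    reflexivity.
  Qed.

  Definition rep (c : carrier) : term :=
    proj1_sig (constructive_indefinite_description _ (mk_surj c)).

  Lemma mk_rep c : mk (rep c) = c.
  Proof. symmetry. exact (proj2_sig (constructive_indefinite_description _ (mk_surj c))). Qed.

  Lemma rep_mk t : limit (Equ (rep (mk t)) t).
  Proof. apply mk_eq. apply mk_rep. Qed.

  Definition term_model : struct := {|
    dom := carrier;
    i0 := mk Zero;
    i1 := fun f a => mk (App1 f (rep a));
    i2 := fun f a b => mk (App2 f (rep a) (rep b));
    i3 := fun f a b c => mk (App3 f (rep a) (rep b) (rep c)) |}.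

  Definition term_model_T (c : term_model) : Prop := limit (Tru (rep c)).

  Lemma eval_term_model sigma t :
    eval term_model (fun n => mk (sigma n)) t = mk (subst_term sigma t).
  Proof.
    induction t; cbn; rewrite ?IHt, ?IHt1, ?IHt2, ?IHt3; auto; apply mk_eq.
    - apply limit_cong with (f := fun r => App1 f r); [|apply rep_mk].
      exists (App1 f (Var 0)). reflexivity.
    - apply limit_trans with (App2 f (subst_term sigma t1) (rep (mk (subst_term sigma t2)))).
      + apply limit_cong with (f := fun r => App2 f r _); [|apply rep_mk].
        eexists (App2 f (Var 0) (_ ↑ 1)). intros r. cbn. now rewrite subst_shift1.
      + apply limit_cong with (f := fun r => App2 f _ r); [|apply rep_mk].
        eexists (App2 f (_ ↑ 1) (Var 0)). intros r. cbn. now rewrite subst_shift1.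
    - apply limit_trans with (App3 f (subst_term sigma t1)
        (rep (mk (subst_term sigma t2))) (rep (mk (subst_term sigma t3)))).
      2: apply limit_trans with (App3 f (subst_term sigma t1)
        (subst_term sigma t2) (rep (mk (subst_term sigma t3)))).
      + apply limit_cong with (f := fun r => App3 f r _ _); [|apply rep_mk].
        eexists (App3 f (Var 0) (_ ↑ 1) (_ ↑ 1)). intros r. cbn. now rewrite !subst_shift1.
      + apply limit_cong with (f := fun r => App3 f _ r _); [|apply rep_mk].
        eexists (App3 f (_ ↑ 1) (Var 0) (_ ↑ 1)). intros r. cbn. now rewrite !subst_shift1.
      + apply limit_cong with (f := fun r => App3 f _ _ r); [|apply rep_mk].
        eexists (App3 f (_ ↑ 1) (_ ↑ 1) (Var 0)). intros r. cbn. now rewrite !subst_shift1.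
  Qed.

  Lemma limit_Tru s t : limit (Equ s t) -> limit (Tru s) -> limit (Tru t).
  Proof. apply (limit_repl s t (Tru (Var 0))). Qed.

  Lemma sat_term_model A : forall sigma,
    sat term_model term_model_T (fun n => mk (sigma n)) A <-> limit (subst sigma A).
  Proof.
    induction A; intros sigma; cbn.
    - rewrite !eval_term_model. apply mk_eq.
    - rewrite eval_term_model. unfold term_model_T.
      split; apply limit_Tru; auto using rep_mk, limit_sym.
    - rewrite limit_Not, IHA. tauto.
    - rewrite limit_And, IHA1, IHA2. tauto.
    - rewrite limit_All.
      assert (E : forall t, (mk t .: (fun n => mk (sigma n))) = fun n => mk ((t .: sigma) n)).
      { intros t. extensionality n. destruct n; reflexivity. }
      assert (E2 : forall t, inst t (subst (up sigma) A) = subst (t .: sigma) A).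
      { intros t. rewrite inst_scons, subst_comp. f_equal. extensionality n.
        destruct n; cbn; [reflexivity|]. apply subst_shift1. }
      split.
      + intros K t. rewrite E2. apply IHA. rewrite <- E. apply K.
      + intros K x. destruct (mk_surj x) as [t ->]. rewrite E. apply IHA. rewrite <- E2. apply K.
  Qed.

  Lemma term_model_spec A : limit A <-> sat term_model term_model_T (fun n => mk (Var n)) A.
  Proof. rewrite sat_term_model, subst_id. reflexivity. Qed.
End Henkin.

Lemma pair_inj x y x' y' : pair x y = pair x' y' -> x = x' /\ y = y'.
Proof. unfold pair. intros E. assert (x + y = x' + y') by nia. nia. Qed.

Lemma num1_inj f g : num1 f = num1 g -> f = g.
Proof. destruct f, g; cbn; congruence. Qed.
Lemma num2_inj f g : num2 f = num2 g -> f = g.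
Proof. destruct f, g; cbn; congruence. Qed.
Lemma num3_inj f g : num3 f = num3 g -> f = g.
Proof. destruct f, g; cbn; congruence. Qed.

Lemma code_term_inj s : forall t, code_term s = code_term t -> s = t.
Proof.
  induction s; intros []; cbn [code_term]; intros E;
    repeat (apply pair_inj in E as [? E]); try discriminate;
    repeat match goal with K : pair _ _ = _ |- _ => apply pair_inj in K as [? K] end;
    f_equal; auto using num1_inj, num2_inj, num3_inj.
Qed.

Lemma code_inj A : forall B, code A = code B -> A = B.
Proof.
  induction A; intros []; cbn [code]; intros E;
    apply pair_inj in E as [? E]; try discriminate;
    try apply pair_inj in E as [? E];
    f_equal; auto using code_term_inj.
Qed.

(** The Goedel numbering is injective. *)
Lemma form_enumerable : exists enum : nat -> form, forall A, exists n, enum n = A.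
Proof.
  exists (fun n => epsilon (inhabits (Equ Zero Zero)) (fun A => code A = n)).
  intros A. exists (code A). apply code_inj.
  apply (epsilon_spec (inhabits (Equ Zero Zero)) (fun B => code B = code A)). now exists A.
Qed.

Theorem completeness Th A : (forall B, Th B -> sentence B) ->
  (forall M Tr, model M Tr Th -> forall rho, sat M Tr rho A) -> proves Th A.
Proof.
  intros HTh HA. unfold proves. apply inconsistent_Not. intros HC.
  destruct form_enumerable as [enum Henum].
  pose proof (term_model_spec Th HTh enum Henum [Not A] HC) as Hspec.
  apply (limit_consistent Th HTh enum [Not A] HC A).
  - apply Hspec. apply HA. intros B HB rho.
    (* an assignment in the term model is a substitution, which leaves sentences alone *)
    assert (E : rho = fun n => mk Th HTh enum [Not A] (rep Th HTh enum [Not A] (rho n))).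
    { extensionality n. symmetry. apply mk_rep. }
    rewrite E. apply (sat_term_model Th HTh enum Henum [Not A] HC).
    rewrite subst_sentence by auto. exists 0. now apply d_ax.
  - exists 0. apply d_hyp. now left.
Qed.
(** * Satisfaction *)

Section Sat.
  Context (M : struct) (Tr : M -> Prop).
  Implicit Types rho : nat -> M.

  Lemma eval_subst rho sigma t :
    eval M rho (subst_term sigma t) = eval M (fun n => eval M rho (sigma n)) t.
  Proof. induction t; cbn; congruence. Qed.

  Lemma eval_lift rho n t : eval M rho (t ↑ n) = eval M (fun i => rho (n + i)) t.
  Proof. apply eval_subst. Qed.

  Lemma sat_subst A : forall rho sigma,
    sat M Tr rho (subst sigma A) <-> sat M Tr (fun n => eval M rho (sigma n)) A.
  Proof.
    induction A; intros rho sigma; cbn; rewrite ?eval_subst; try tauto.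
    - now rewrite IHA.
    - now rewrite IHA1, IHA2.
    - assert (E : forall x, (fun n => eval M (x .: rho) (up sigma n))
                  = (x .: (fun n => eval M rho (sigma n)))).
      { intros x. extensionality n. destruct n; cbn; [reflexivity|]. now rewrite eval_lift. }
      split; intros H x; specialize (H x); [rewrite <- E | rewrite IHA, E]; [now apply IHA|exact H].
  Qed.

  Lemma sat_or rho A B : sat M Tr rho (A ⊔ B) <-> sat M Tr rho A \/ sat M Tr rho B.
  Proof. cbn. tauto. Qed.

  Lemma sat_imp rho A B : sat M Tr rho (A ⟶ B) <-> (sat M Tr rho A -> sat M Tr rho B).
  Proof. cbn. tauto. Qed.

  Lemma sat_iff rho A B : sat M Tr rho (A ⟷ B) <-> (sat M Tr rho A <-> sat M Tr rho B).
  Proof. cbn. tauto. Qed.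

  Lemma sat_ex rho A : sat M Tr rho (Ex A) <-> exists x, sat M Tr (x .: rho) A.
  Proof.
    cbn. split; [intros H|intros [x H] K; exact (K x H)].
    apply NNPP. intros K. apply H. intros x Hx. eauto.
  Qed.

  Lemma sat_foralls n A : (forall rho, sat M Tr rho (foralls n A)) -> forall rho, sat M Tr rho A.
  Proof.
    induction n as [|n IH]; cbn; intros H; [exact H|].
    apply IH. intros rho.
    replace rho with (rho 0 .: (fun n => rho (S n))); [apply H|].
    extensionality i. destruct i; reflexivity.
  Qed.
End Sat.

Lemma ex_congr {X} (P Q : X -> Prop) : (forall x, P x <-> Q x) ->
  ((exists x, P x) <-> exists x, Q x).
Proof. firstorder. Qed.

Lemma all_congr {X} (P Q : X -> Prop) : (forall x, P x <-> Q x) ->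
  ((forall x, P x) <-> forall x, Q x).
Proof. firstorder. Qed.

Lemma imp_congr (P P' Q Q' : Prop) : (P <-> P') -> (Q <-> Q') -> ((P -> Q) <-> (P' -> Q')).
Proof. tauto. Qed.

Lemma and_congr (P P' Q Q' : Prop) : (P <-> P') -> (Q <-> Q') -> (P /\ Q <-> P' /\ Q').
Proof. tauto. Qed.

Lemma or_congr (P P' Q Q' : Prop) : (P <-> P') -> (Q <-> Q') -> (P \/ Q <-> P' \/ Q').
Proof. tauto. Qed.

(** * Arithmetic in a model *)

Section Model.
  Context (M : struct) (Tr : M -> Prop) (HPA : model M Tr PA).
  Implicit Types rho : nat -> M.

  Notation zer := (i0 M).
  Notation sc := (i1 M s_succ).
  Notation "x ⊞ y" := (i2 M s_plus x y) (at level 50, left associativity).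
  Notation "x ⊠ y" := (i2 M s_mult x y) (at level 40, left associativity).

  (** ** Definable predicates and induction *)

  (** Induction in M is limited to predicates that are definable by a formula.  The
      predicates below take assignments as arguments, so that definability can be
      established by recursion on the shape of a predicate; a quantifier shifts the
      variables as in de Bruijn syntax. *)

  Definition DefP (P : (nat -> M) -> Prop) : Prop :=
    exists A, forall rho, P rho <-> sat M Tr rho A.
  Definition DefT (f : (nat -> M) -> M) : Prop :=
    exists t, forall rho, f rho = eval M rho t.

  Lemma DefT_var n : DefT (fun rho => rho n).
  Proof. exists (Var n). reflexivity. Qed.
  Lemma DefT_zero : DefT (fun _ => zer).
  Proof. exists Zero. reflexivity. Qed.
  Lemma DefT_app1 h f : DefT f -> DefT (fun rho => i1 M h (f rho)).
  Proof. intros [t Ht]. exists (App1 h t). intros. cbn. now rewrite Ht. Qed.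
  Lemma DefT_app2 h f g : DefT f -> DefT g -> DefT (fun rho => i2 M h (f rho) (g rho)).
  Proof. intros [t Ht] [s Hs]. exists (App2 h t s). intros. cbn. now rewrite Ht, Hs. Qed.
  Lemma DefT_app3 h f g k : DefT f -> DefT g -> DefT k ->
    DefT (fun rho => i3 M h (f rho) (g rho) (k rho)).
  Proof.
    intros [t Ht] [s Hs] [r Hr]. exists (App3 h t s r). intros. cbn. now rewrite Ht, Hs, Hr.
  Qed.

  Lemma DefP_eq f g : DefT f -> DefT g -> DefP (fun rho => f rho = g rho).
  Proof. intros [t Ht] [s Hs]. exists (Equ t s). intros. cbn. now rewrite Ht, Hs. Qed.
  Lemma DefP_Tr f : DefT f -> DefP (fun rho => Tr (f rho)).
  Proof. intros [t Ht]. exists (Tru t). intros. cbn. now rewrite Ht. Qed.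
  Lemma DefP_not P : DefP P -> DefP (fun rho => ~ P rho).
  Proof. intros [A HA]. exists (Not A). intros. cbn. now rewrite HA. Qed.
  Lemma DefP_False : DefP (fun _ => False).
  Proof. exists (¬ Zero ≐ Zero). intros. cbn. intuition. Qed.
  Lemma DefP_and P Q : DefP P -> DefP Q -> DefP (fun rho => P rho /\ Q rho).
  Proof. intros [A HA] [B HB]. exists (And A B). intros. cbn. now rewrite HA, HB. Qed.
  Lemma DefP_or P Q : DefP P -> DefP Q -> DefP (fun rho => P rho \/ Q rho).
  Proof. intros [A HA] [B HB]. exists (Or A B). intros. now rewrite sat_or, HA, HB. Qed.
  Lemma DefP_imp P Q : DefP P -> DefP Q -> DefP (fun rho => P rho -> Q rho).
  Proof. intros [A HA] [B HB]. exists (Imp A B). intros. now rewrite sat_imp, HA, HB. Qed.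
  Lemma DefP_iff P Q : DefP P -> DefP Q -> DefP (fun rho => P rho <-> Q rho).
  Proof. intros [A HA] [B HB]. exists (Iff A B). intros. now rewrite sat_iff, HA, HB. Qed.
  Lemma DefP_all (Q : (nat -> M) -> M -> Prop) :
    DefP (fun rho => Q (fun n => rho (S n)) (rho 0)) -> DefP (fun rho => forall y, Q rho y).
  Proof.
    intros [A HA]. exists (All A). intros rho. cbn. apply all_congr. intros x. rewrite <- HA. reflexivity.
  Qed.
  Lemma DefP_ex (Q : (nat -> M) -> M -> Prop) :
    DefP (fun rho => Q (fun n => rho (S n)) (rho 0)) -> DefP (fun rho => exists y, Q rho y).
  Proof.
    intros [A HA]. exists (Ex A). intros rho. rewrite sat_ex. apply ex_congr.
    intros x. rewrite <- HA. reflexivity.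
  Qed.
  (** Substitution of definable functions for the variables of a formula. *)
  Lemma DefP_formula (P : (nat -> M) -> Prop) A (f : nat -> (nat -> M) -> M) :
    (forall rho, P rho <-> sat M Tr (fun n => f n rho) A) -> (forall n, DefT (f n)) -> DefP P.
  Proof.
    intros HP Hf.
    destruct (choice (fun n t => forall rho, f n rho = eval M rho t) Hf) as [sigma Hs].
    exists (subst sigma A). intros rho. rewrite HP, sat_subst.
    replace (fun n => eval M rho (sigma n)) with (fun n => f n rho); [reflexivity|].
    extensionality n. apply Hs.
  Qed.

  Lemma induction_env P : DefP P -> forall rho, P (zer .: rho) ->
    (forall x, P (x .: rho) -> P (sc x .: rho)) -> forall x, P (x .: rho).
  Proof.
    intros [A HA] rho H0 HS x.
    destruct (form_below_ex (induction A)) as [n Hn].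
    assert (Hind : forall rho, sat M Tr rho (induction A)).
    { apply (sat_foralls M Tr n). apply HPA. right. right. exists n, A. auto. }
    specialize (Hind rho). unfold induction in Hind.
    rewrite sat_imp in Hind. cbn [sat] in Hind. apply HA. apply Hind. split.
    - rewrite inst_scons, sat_subst.
      replace (fun n => eval M rho ((Zero .: Var) n)) with (zer .: rho); [now apply HA|].
      extensionality i. destruct i; reflexivity.
    - intros y. rewrite sat_imp, sat_subst. intros Hy. apply HA, HS in Hy. apply HA in Hy.
      match goal with |- sat _ _ ?r _ => replace r with (sc y .: rho); [exact Hy|] end.
      extensionality i. destruct i; reflexivity.
  Qed.

  Lemma ind (P : M -> Prop) : DefP (fun rho => P (rho 0)) ->
    P zer -> (forall x, P x -> P (sc x)) -> forall x, P x.
  Proof. intros HP H0 HS x. exact (induction_env _ HP (fun _ => zer) H0 HS x). Qed.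

  (** The predicates and functions for which definability has been proved are added
      to [defp_known] as they are introduced. *)
  Ltac defp_known := fail.
  Ltac defp_step :=
    cbv beta;
    first
      [ assumption
      | apply DefT_var | apply DefT_zero | apply DefT_app1 | apply DefT_app2 | apply DefT_app3
      | defp_known
      | apply DefP_eq | apply DefP_Tr | apply DefP_False
      | apply DefP_iff | apply DefP_and | apply DefP_or | apply DefP_not | apply DefP_imp
      | apply DefP_ex | apply DefP_all ].
  Ltac defp := repeat defp_step.

  (** ** The semiring of numbers *)

  Let env0 : nat -> M := fun _ => zer.

  Lemma arith_sat n A : nth_error arith_axioms n = Some A -> forall rho, sat M Tr rho A.
  Proof. intros H. apply HPA. left. eapply nth_error_In; eauto. Qed.

  Lemma sc_zer x : sc x <> zer.
  Proof. exact (arith_sat 0 _ eq_refl env0 x). Qed.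
  Lemma sc_inj x y : sc x = sc y -> x = y.
  Proof. pose proof (arith_sat 1 _ eq_refl env0 x y) as H. rewrite sat_imp in H. exact H. Qed.
  Lemma add_0_r x : x ⊞ zer = x.
  Proof. exact (arith_sat 2 _ eq_refl env0 x). Qed.
  Lemma add_S_r x y : x ⊞ sc y = sc (x ⊞ y).
  Proof. exact (arith_sat 3 _ eq_refl env0 x y). Qed.
  Lemma mul_0_r x : x ⊠ zer = zer.
  Proof. exact (arith_sat 4 _ eq_refl env0 x). Qed.
  Lemma mul_S_r x y : x ⊠ sc y = x ⊠ y ⊞ x.
  Proof. exact (arith_sat 5 _ eq_refl env0 x y). Qed.

  Lemma add_0_l x : zer ⊞ x = x.
  Proof.
    revert x. apply ind; [defp| |].
    - apply add_0_r.
    - intros x IH. now rewrite add_S_r, IH.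
  Qed.
  Lemma add_S_l y x : sc x ⊞ y = sc (x ⊞ y).
  Proof.
    revert y x. apply (ind (fun y => forall x, sc x ⊞ y = sc (x ⊞ y))); [defp| |].
    - intros x. now rewrite !add_0_r.
    - intros y IH x. now rewrite !add_S_r, IH.
  Qed.
  Lemma add_comm x y : x ⊞ y = y ⊞ x.
  Proof.
    revert x y. apply (ind (fun x => forall y, x ⊞ y = y ⊞ x)); [defp| |].
    - intros y. now rewrite add_0_l, add_0_r.
    - intros x IH y. now rewrite add_S_l, add_S_r, IH.
  Qed.
  Lemma add_assoc x y z : x ⊞ (y ⊞ z) = x ⊞ y ⊞ z.
  Proof.
    revert x y z. apply (ind (fun x => forall y z, x ⊞ (y ⊞ z) = x ⊞ y ⊞ z)); [defp| |].
    - intros. now rewrite !add_0_l.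
    - intros x IH y z. now rewrite !add_S_l, IH.
  Qed.
  Lemma mul_0_l x : zer ⊠ x = zer.
  Proof.
    revert x. apply ind; [defp| |].
    - apply mul_0_r.
    - intros x IH. now rewrite mul_S_r, IH, add_0_r.
  Qed.
  Lemma mul_S_l y x : sc x ⊠ y = x ⊠ y ⊞ y.
  Proof.
    revert y x. apply (ind (fun y => forall x, sc x ⊠ y = x ⊠ y ⊞ y)); [defp| |].
    - intros. now rewrite !mul_0_r, add_0_r.
    - intros y IH x. rewrite !mul_S_r, IH, !add_S_r, <- !add_assoc. f_equal. f_equal. apply add_comm.
  Qed.
  Lemma mul_comm x y : x ⊠ y = y ⊠ x.
  Proof.
    revert x y. apply (ind (fun x => forall y, x ⊠ y = y ⊠ x)); [defp| |].
    - intros y. now rewrite mul_0_l, mul_0_r.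
    - intros x IH y. now rewrite mul_S_l, mul_S_r, IH.
  Qed.
  Lemma mul_add_distr_r x y z : (x ⊞ y) ⊠ z = x ⊠ z ⊞ y ⊠ z.
  Proof.
    revert x y z. apply (ind (fun x => forall y z, (x ⊞ y) ⊠ z = x ⊠ z ⊞ y ⊠ z)); [defp| |].
    - intros. now rewrite mul_0_l, !add_0_l.
    - intros x IH y z. rewrite add_S_l, !mul_S_l, IH, <- !add_assoc. f_equal. apply add_comm.
  Qed.
  Lemma mul_assoc x y z : x ⊠ (y ⊠ z) = x ⊠ y ⊠ z.
  Proof.
    revert x y z. apply (ind (fun x => forall y z, x ⊠ (y ⊠ z) = x ⊠ y ⊠ z)); [defp| |].
    - intros. now rewrite !mul_0_l.
    - intros x IH y z. now rewrite !mul_S_l, mul_add_distr_r, IH.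
  Qed.

  Definition one : M := sc zer.
  Lemma sc_one x : sc x = x ⊞ one.
  Proof. unfold one. now rewrite add_S_r, add_0_r. Qed.

  Lemma model_semiring :
    semi_ring_theory zer one (i2 M s_plus) (i2 M s_mult) (@eq M).
  Proof.
    constructor; auto using add_0_l, add_comm, add_assoc, mul_0_l, mul_comm, mul_assoc,
      mul_add_distr_r.
    intros x. unfold one. now rewrite mul_S_l, mul_0_l, add_0_l.
  Qed.
  Add Ring model_ring : model_semiring.
  Ltac mring := rewrite ?sc_one; ring.

  Lemma add_cancel_l x y z : x ⊞ y = x ⊞ z -> y = z.
  Proof.
    revert x y z. apply (ind (fun x => forall y z, x ⊞ y = x ⊞ z -> y = z)); [defp| |].
    - intros y z. now rewrite !add_0_l.
    - intros x IH y z. rewrite !add_S_l. intros E. now apply IH, sc_inj.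
  Qed.
  Lemma zer_or_sc x : x = zer \/ exists y, x = sc y.
  Proof. revert x. apply ind; [defp|auto|]. intros x _. eauto. Qed.
  Lemma add_eq_0 x y : x ⊞ y = zer -> x = zer.
  Proof.
    destruct (zer_or_sc x) as [->|[x' ->]]; [auto|]. rewrite add_S_l. intros E.
    now apply sc_zer in E.
  Qed.

  (** ** Order *)

  Definition Le x y := exists z, x ⊞ z = y.
  Definition Lt x y := exists z, x ⊞ sc z = y.

  Lemma DefP_Le f g : DefT f -> DefT g -> DefP (fun rho => Le (f rho) (g rho)).
  Proof.
    intros [t Ht] [s Hs]. exists (le t s). intros rho. unfold Le, le. rewrite sat_ex.
    apply ex_congr. intros x. cbn. now rewrite !eval_lift, Ht, Hs.
  Qed.
  Lemma DefP_Lt f g : DefT f -> DefT g -> DefP (fun rho => Lt (f rho) (g rho)).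
  Proof.
    intros [t Ht] [s Hs]. exists (lt t s). intros rho. unfold Lt, lt. rewrite sat_ex.
    apply ex_congr. intros x. cbn. now rewrite !eval_lift, Ht, Hs.
  Qed.
  Ltac defp_known ::= first [apply DefP_Le | apply DefP_Lt].

  Lemma Le_refl x : Le x x.
  Proof. exists zer. apply add_0_r. Qed.
  Lemma Le_0 x : Le zer x.
  Proof. exists x. apply add_0_l. Qed.
  Lemma Le_add x y : Le x (x ⊞ y).
  Proof. now exists y. Qed.
  Lemma Le_add_l x y : Le y (x ⊞ y).
  Proof. exists x. apply add_comm. Qed.
  Lemma Le_trans x y z : Le x y -> Le y z -> Le x z.
  Proof. intros [a <-] [b <-]. exists (a ⊞ b). ring. Qed.
  Lemma Lt_Le x y : Lt x y -> Le x y.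
  Proof. intros [a <-]. now exists (sc a). Qed.
  Lemma Lt_S x y : Lt x (sc y) <-> Le x y.
  Proof.
    split.
    - intros [z E]. exists z. rewrite add_S_r in E. now apply sc_inj.
    - intros [z <-]. exists z. now rewrite add_S_r.
  Qed.
  Lemma Lt_Le_trans x y z : Lt x y -> Le y z -> Lt x z.
  Proof. intros [a <-] [b <-]. exists (a ⊞ b). mring. Qed.
  Lemma Le_Lt_trans x y z : Le x y -> Lt y z -> Lt x z.
  Proof. intros [a <-] [b <-]. exists (a ⊞ b). mring. Qed.
  Lemma Lt_S_diag x : Lt x (sc x).
  Proof. apply Lt_S, Le_refl. Qed.
  Lemma Lt_0 x : ~ Lt x zer.
  Proof. intros [z E]. rewrite add_S_r in E. now apply sc_zer in E. Qed.
  Lemma Lt_irrefl x : ~ Lt x x.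
  Proof.
    intros [z E]. rewrite <- (add_0_r x) in E at 2. apply add_cancel_l in E.
    now apply sc_zer in E.
  Qed.
  Lemma Le_cases x y : Le x y -> x = y \/ Lt x y.
  Proof.
    intros [z <-]. destruct (zer_or_sc z) as [->|[w ->]].
    - left. symmetry. apply add_0_r.
    - right. now exists w.
  Qed.
  Lemma Le_Lt_S x y : Lt x y -> Le (sc x) y.
  Proof. intros [z <-]. exists z. mring. Qed.
  Lemma Lt_or_Le x y : Lt x y \/ Le y x.
  Proof.
    revert x y. apply (ind (fun x => forall y, Lt x y \/ Le y x)); [defp| |].
    - intros y. destruct (zer_or_sc y) as [->|[z ->]].
      + right. apply Le_refl.
      + left. exists z. apply add_0_l.
    - intros x IH y. destruct (IH y) as [H|H].
      + apply Le_Lt_S, Le_cases in H as [<-|H]; [right; apply Le_refl|now left].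
      + right. eapply Le_trans; [exact H|]. apply Lt_Le, Lt_S_diag.
  Qed.
  Lemma Lt_trichotomy x y : Lt x y \/ x = y \/ Lt y x.
  Proof. destruct (Lt_or_Le x y) as [H|H]; [auto|]. apply Le_cases in H as [->|H]; auto. Qed.
  (** Course-of-values induction.  It yields induction on expressions, because the
      immediate subexpressions have smaller codes. *)
  Lemma strong_ind (P : M -> Prop) : DefP (fun rho => P (rho 0)) ->
    (forall x, (forall y, Lt y x -> P y) -> P x) -> forall x, P x.
  Proof.
    intros HP H x. assert (K : forall x y, Lt y x -> P y).
    { apply (ind (fun x => forall y, Lt y x -> P y)).
      - destruct HP as [A HA]. defp.
        apply (DefP_formula _ A (fun n rho => rho n)); [|intros; apply DefT_var].
        intros rho. apply HA.
      - intros y Hy. now apply Lt_0 in Hy.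
      - intros z IH y Hy. apply Lt_S, Le_cases in Hy as [->|Hy]; [|auto]. apply H, IH. }
    apply (K (sc x)). apply Lt_S_diag.
  Qed.

  (** ** Pairs *)

  Definition PR x y := (x ⊞ y) ⊠ (x ⊞ y) ⊞ x.

  Lemma Le_mul x y x' y' : Le x x' -> Le y y' -> Le (x ⊠ y) (x' ⊠ y').
  Proof. intros [a <-] [b <-]. exists (x ⊠ b ⊞ a ⊠ y ⊞ a ⊠ b). ring. Qed.

  Lemma PR_lt_sum x y x' y' : Lt (x ⊞ y) (x' ⊞ y') -> Lt (PR x y) (PR x' y').
  Proof.
    intros H. apply Le_Lt_S in H. unfold PR.
    eapply Lt_Le_trans; [|apply Le_add]. eapply Lt_Le_trans; [|exact (Le_mul _ _ _ _ H H)].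
    exists (x ⊞ y ⊞ y). mring.
  Qed.
  Lemma PR_inj x y x' y' : PR x y = PR x' y' -> x = x' /\ y = y'.
  Proof.
    intros E. destruct (Lt_trichotomy (x ⊞ y) (x' ⊞ y')) as [H|[H|H]].
    - apply PR_lt_sum in H. rewrite E in H. now apply Lt_irrefl in H.
    - unfold PR in E. rewrite H in E. apply add_cancel_l in E as ->.
      split; [reflexivity|]. eapply add_cancel_l; eauto.
    - apply PR_lt_sum in H. rewrite E in H. now apply Lt_irrefl in H.
  Qed.
  Lemma Le_square x : Le x (x ⊠ x).
  Proof.
    destruct (zer_or_sc x) as [->|[y ->]]; [apply Le_0|].
    exists (y ⊠ sc y). mring.
  Qed.
  Lemma Le_PR_l x y : Le x (PR x y).
  Proof. apply Le_add_l. Qed.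
  Lemma Le_PR_r x y : Le y (PR x y).
  Proof.
    eapply Le_trans; [|apply Le_add]. eapply Le_trans; [|apply Le_square]. apply Le_add_l.
  Qed.
  Lemma Lt_PR_r x y : Lt y (PR (sc x) y).
  Proof.
    unfold PR. eapply Lt_Le_trans with (sc x ⊞ y); [exists x; mring|].
    eapply Le_trans; [apply Le_square | apply Le_add].
  Qed.

  (** ** Finite sets *)

  (** Membership in the set coded by (b, c, d) is divisibility of c by a modulus
      1 + (x + 1) d.  If d is a multiple of 1, ..., b then the moduli are pairwise
      coprime, so c can be taken to be a product of moduli. *)

  Definition Dvd a b := exists q, b = a ⊠ q.
  Definition Md d x := sc (sc x ⊠ d).
  Definition Mem b c d x := Le x b /\ exists q, c = q ⊠ sc (sc x ⊠ d).

  Lemma DefP_Mem f g h k : DefT f -> DefT g -> DefT h -> DefT k ->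
    DefP (fun rho => Mem (f rho) (g rho) (h rho) (k rho)).
  Proof.
    intros Hf Hg Hh Hk. unfold Mem. apply DefP_and; [now apply DefP_Le|].
    destruct Hg as [t Ht], Hh as [s Hs], Hk as [r Hr].
    exists (Ex (t↑1 ≐ v 0 ⊗ succ (succ (r↑1) ⊗ s↑1))). intros rho. rewrite sat_ex.
    apply ex_congr. intros x. cbn. now rewrite !eval_lift, Ht, Hs, Hr.
  Qed.

  Ltac defp_known ::= first [apply DefP_Le | apply DefP_Lt | apply DefP_Mem].

  Lemma Mem_Dvd b c d x : Mem b c d x <-> Le x b /\ Dvd (Md d x) c.
  Proof.
    unfold Mem, Dvd, Md. apply and_congr; [reflexivity|]. apply ex_congr. intros q.
    now rewrite (mul_comm q).
  Qed.

  Lemma Dvd_add_cancel a b c : Dvd a b -> Dvd a (b ⊞ c) -> Dvd a c.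
  Proof.
    intros [p ->] [q E]. destruct (Lt_or_Le q p) as [[r <-]|[r <-]].
    - exists zer. rewrite mul_0_r. assert (K : a ⊠ q ⊞ (c ⊞ a ⊠ sc r) = a ⊠ q ⊞ zer).
      { rewrite add_0_r. etransitivity; [|exact E]. mring. }
      apply add_cancel_l in K. now apply add_eq_0 in K.
    - exists r. apply (add_cancel_l (a ⊠ p)). rewrite E. ring.
  Qed.
  Lemma Dvd_mul_r a b c : Dvd a b -> Dvd a (b ⊠ c).
  Proof. intros [q ->]. exists (q ⊠ c). ring. Qed.
  Lemma Dvd_self_mul a b : Dvd a (b ⊠ a).
  Proof. exists b. ring. Qed.

  (** Modulo 1 + (x + 1) d, the factor d has the inverse - (x + 1). *)
  Lemma Md_coprime_d d x c : Dvd (Md d x) (c ⊠ d) -> Dvd (Md d x) c.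
  Proof.
    intros H. apply (Dvd_add_cancel _ (c ⊠ d ⊠ sc x)); [now apply Dvd_mul_r|].
    replace (c ⊠ d ⊠ sc x ⊞ c) with (c ⊠ Md d x); [apply Dvd_self_mul|].
    unfold Md. mring.
  Qed.
  Lemma Md_coprime_ed d x c e : Dvd e d -> Dvd (Md d x) (c ⊠ e ⊠ d) -> Dvd (Md d x) c.
  Proof.
    intros [k Hk] H. apply Md_coprime_d in H. apply Md_coprime_d. rewrite Hk at 2.
    rewrite mul_assoc. now apply Dvd_mul_r.
  Qed.
  (** Distinct moduli differ by e d, where e is the difference of the indices. *)
  Lemma Md_coprime b d x y c : (forall e, Lt e b -> Dvd (sc e) d) ->
    Le x b -> Le y b -> x <> y -> Dvd (Md d x) (c ⊠ Md d y) -> Dvd (Md d x) c.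
  Proof.
    intros Hd Hx Hy Hxy H.
    assert (K : forall u w e, u ⊞ sc e = w -> Le w b -> Dvd (sc e) d).
    { intros u w e E Hw. apply Hd. eapply Lt_Le_trans; [|exact Hw].
      exists u. rewrite <- E. mring. }
    destruct (Lt_trichotomy x y) as [[e E]|[E|[e E]]]; [|contradiction|].
    - apply (Md_coprime_ed d x c (sc e)); [now apply (K x y)|].
      apply (Dvd_add_cancel _ (c ⊠ Md d x)); [apply Dvd_self_mul|].
      replace (c ⊠ Md d x ⊞ c ⊠ sc e ⊠ d) with (c ⊠ Md d y); [exact H|].
      rewrite <- E. unfold Md. mring.
    - apply (Md_coprime_ed d x c (sc e)); [now apply (K y x)|].
      apply (Dvd_add_cancel _ (c ⊠ Md d y)); [exact H|].
      replace (c ⊠ Md d y ⊞ c ⊠ sc e ⊠ d) with (c ⊠ Md d x); [apply Dvd_self_mul|].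
      rewrite <- E. unfold Md. mring.
  Qed.

  Lemma common_multiple b : exists d, d <> zer /\ forall e, Lt e b -> Dvd (sc e) d.
  Proof.
    revert b. apply ind; [unfold Dvd; defp| |].
    - exists one. split; [apply sc_zer|]. intros e He. now apply Lt_0 in He.
    - intros b [d [Hd0 Hd]]. exists (d ⊠ sc b). split.
      { rewrite mul_S_r, add_comm. intros E. now apply add_eq_0 in E. }
      intros e He. apply Lt_S, Le_cases in He as [->|He].
      + apply Dvd_self_mul.
      + apply Dvd_mul_r. auto.
  Qed.

  (** Hence c = 1 codes the empty set. *)
  Lemma Md_not_unit d x : d <> zer -> ~ Dvd (Md d x) one.
  Proof.
    intros Hd [q E]. destruct (zer_or_sc d) as [->|[d' ->]]; [contradiction|].
    destruct (zer_or_sc q) as [->|[q' ->]].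
    - rewrite mul_0_r in E. now apply sc_zer in E.
    - unfold Md, one in E. rewrite !mul_S_r, !mul_S_l, !add_S_r in E. apply sc_inj in E.
      symmetry in E. rewrite ?add_S_l, ?add_S_r in E. now apply sc_zer in E.
  Qed.

  Lemma comprehension Q : DefP Q -> forall rho b,
    exists c d, forall x, Mem b c d x <-> Le x b /\ Q (x .: rho).
  Proof.
    intros HQ rho b. destruct (common_multiple b) as [d [Hd0 Hd]].
    (* c is built by running through the candidates x < n, up to n = b + 1 *)
    assert (K : forall n, exists c, forall x,
      Mem b c d x <-> Lt x n /\ Le x b /\ Q (x .: rho)).
    { apply (induction_env (fun rho => exists c, forall x, Mem (rho 1) c (rho 2) x <->
          Lt x (rho 0) /\ Le x (rho 1) /\ Q (x .: fun n => rho (3 + n)))) with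
        (rho := b .: d .: rho).
      - defp. destruct HQ as [A HA].
        apply (DefP_formula _ A (fun n rho => (rho 0 .: fun n => rho (S (S (3 + n)))) n)).
        + intros r. rewrite <- HA. reflexivity.
        + intros [|n]; cbn; apply DefT_var.
      - cbn. exists one. intros x. rewrite Mem_Dvd. split.
        + intros [_ H]. now apply Md_not_unit in H.
        + intros [H _]. now apply Lt_0 in H.
      - cbn. intros n [c Hc].
        destruct (classic (Le n b /\ Q (n .: rho))) as [[Hn HQn]|Hn].
        + exists (c ⊠ Md d n). intros x. rewrite Lt_S. split.
          * rewrite Mem_Dvd. intros [Hx H].
            destruct (classic (x = n)) as [->|Hxn]; [auto using Le_refl|].
            apply Md_coprime with (b := b) in H; auto.
            assert (H' : Mem b c d x) by now apply Mem_Dvd.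
            apply Hc in H' as [H1 H2]. split; [now apply Lt_Le|exact H2].
          * intros [H1 [H2 H3]]. apply Mem_Dvd. split; [exact H2|].
            apply Le_cases in H1 as [->|H1]; [apply Dvd_self_mul|].
            apply Dvd_mul_r. assert (H' : Mem b c d x) by now apply Hc.
            now apply Mem_Dvd in H'.
        + exists c. intros x. rewrite Hc, Lt_S. split.
          * intros [H1 H2]. split; [now apply Lt_Le|exact H2].
          * intros [H1 H2]. split; [|exact H2].
            apply Le_cases in H1 as [->|H1]; [tauto|exact H1]. }
    destruct (K (sc b)) as [c Hc]. exists c, d. intros x. rewrite Hc, Lt_S. tauto.
  Qed.

  (** ** Numerals and codes *)

  Fixpoint nm (k : nat) : M := match k with 0 => zer | S k => sc (nm k) end.

  Lemma eval_numeral rho k : eval M rho (numeral k) = nm k.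
  Proof. induction k; cbn; congruence. Qed.
  Lemma nm_add a b : nm (a + b) = nm a ⊞ nm b.
  Proof. induction a; cbn; [now rewrite add_0_l|]. now rewrite IHa, add_S_l. Qed.
  Lemma nm_mul a b : nm (a * b) = nm a ⊠ nm b.
  Proof.
    induction a; cbn; [now rewrite mul_0_l|]. now rewrite nm_add, IHa, mul_S_l, add_comm.
  Qed.
  Lemma nm_pair a b : nm (pair a b) = PR (nm a) (nm b).
  Proof. unfold pair, PR. now rewrite !nm_add, nm_mul, nm_add. Qed.
  Lemma nm_inj a : forall b, nm a = nm b -> a = b.
  Proof.
    induction a; intros [|b]; cbn; intros E; auto.
    - symmetry in E. now apply sc_zer in E.
    - now apply sc_zer in E.
    - f_equal. now apply IHa, sc_inj.
  Qed.
  Lemma nm_Lt a b : a < b -> Lt (nm a) (nm b).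
  Proof.
    induction 1; cbn; [apply Lt_S_diag|]. apply Lt_S. now apply Lt_Le.
  Qed.

  Definition CV i := PR (nm 0) i.
  Definition CZ := PR (nm 1) zer.
  Definition C1 f s := PR (nm 2) (PR f s).
  Definition C2 f s t := PR (nm 3) (PR f (PR s t)).
  Definition C3 f r s t := PR (nm 4) (PR f (PR r (PR s t))).
  Notation EQ := (i2 M s_eq).
  Notation TR := (i1 M s_tr).
  Notation NEG := (i1 M s_neg).
  Notation AND := (i2 M s_and).
  Notation ALL := (i1 M s_all).
  Notation NUM := (i1 M s_num).
  Notation SUB := (i3 M s_sub).

  Lemma syn_sat n A : nth_error syntax_axioms n = Some A -> forall rho, sat M Tr rho A.
  Proof. intros H. apply HPA. right. left. eapply nth_error_In; eauto. Qed.

  Lemma EQ_code s t : EQ s t = PR (nm 5) (PR s t).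
  Proof. exact (syn_sat 0 _ eq_refl env0 s t). Qed.
  Lemma TR_code t : TR t = PR (nm 6) t.
  Proof. exact (syn_sat 1 _ eq_refl env0 t). Qed.
  Lemma NEG_code u : NEG u = PR (nm 7) u.
  Proof. exact (syn_sat 2 _ eq_refl env0 u). Qed.
  Lemma AND_code u w : AND u w = PR (nm 8) (PR u w).
  Proof. exact (syn_sat 3 _ eq_refl env0 u w). Qed.
  Lemma ALL_code u : ALL u = PR (nm 9) u.
  Proof. exact (syn_sat 4 _ eq_refl env0 u). Qed.
  Lemma NUM_zer : NUM zer = CZ.
  Proof. exact (syn_sat 5 _ eq_refl env0). Qed.
  Lemma NUM_sc x : NUM (sc x) = C1 (nm (num1 s_succ)) (NUM x).
  Proof. exact (syn_sat 6 _ eq_refl env0 x). Qed.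
  Lemma SUB_var_lt k i t : Lt i k -> SUB k (CV i) t = CV i.
  Proof.
    intros H. pose proof (syn_sat 7 _ eq_refl env0 k t i) as K.
    rewrite sat_imp in K. apply K. unfold lt. rewrite sat_ex. exact H.
  Qed.
  Lemma SUB_var_eq k t : SUB k (CV k) t = t.
  Proof. exact (syn_sat 8 _ eq_refl env0 k t). Qed.
  Lemma SUB_var_gt k i t : Le k i -> SUB k (CV (sc i)) t = CV i.
  Proof.
    intros H. pose proof (syn_sat 9 _ eq_refl env0 k t i) as K.
    rewrite sat_imp in K. apply K. unfold le. rewrite sat_ex. exact H.
  Qed.
  Lemma SUB_zero k t : SUB k CZ t = CZ.
  Proof. exact (syn_sat 10 _ eq_refl env0 k t). Qed.
  Lemma SUB_C1 k f s t : SUB k (C1 f s) t = C1 f (SUB k s t).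
  Proof. exact (syn_sat 11 _ eq_refl env0 f s k t). Qed.
  Lemma SUB_C2 k f s s' t : SUB k (C2 f s s') t = C2 f (SUB k s t) (SUB k s' t).
  Proof. exact (syn_sat 12 _ eq_refl env0 f s s' k t). Qed.
  Lemma SUB_C3 k f r s s' t :
    SUB k (C3 f r s s') t = C3 f (SUB k r t) (SUB k s t) (SUB k s' t).
  Proof. exact (syn_sat 13 _ eq_refl env0 f r s s' k t). Qed.
  Lemma SUB_EQ k s s' t : SUB k (EQ s s') t = EQ (SUB k s t) (SUB k s' t).
  Proof. exact (syn_sat 14 _ eq_refl env0 s s' k t). Qed.
  Lemma SUB_TR k s t : SUB k (TR s) t = TR (SUB k s t).
  Proof. exact (syn_sat 15 _ eq_refl env0 s k t). Qed.
  Lemma SUB_NEG k u t : SUB k (NEG u) t = NEG (SUB k u t).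
  Proof. exact (syn_sat 16 _ eq_refl env0 u k t). Qed.
  Lemma SUB_AND k u w t : SUB k (AND u w) t = AND (SUB k u t) (SUB k w t).
  Proof. exact (syn_sat 17 _ eq_refl env0 u w k t). Qed.
  Lemma SUB_ALL k u t : SUB k (ALL u) t = ALL (SUB (sc k) u t).
  Proof. exact (syn_sat 18 _ eq_refl env0 u k t). Qed.

  Lemma Lt_code_r n x y : Le x y -> Lt x (PR (nm (S n)) y).
  Proof. intros H. eapply Le_Lt_trans; [exact H|apply Lt_PR_r]. Qed.

  Ltac le_pr := solve [ apply Le_refl
    | repeat first [ apply Le_PR_l | apply Le_PR_r | eapply Le_trans; [|apply Le_PR_r] ] ].

  (** [codes]: take apart equations between codes of expressions. *)
  Ltac codes :=
    unfold CV, CZ, C1, C2, C3 in *;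
    rewrite ?EQ_code, ?TR_code, ?NEG_code, ?AND_code, ?ALL_code in *;
    repeat match goal with
      | H : PR _ _ = PR _ _ |- _ => apply PR_inj in H; destruct H
      | H : nm _ = nm _ |- _ => apply nm_inj in H; try discriminate H
      | H : num1 _ = num1 _ |- _ => apply num1_inj in H
      | H : num2 _ = num2 _ |- _ => apply num2_inj in H
      | H : num3 _ = num3 _ |- _ => apply num3_inj in H
      end; subst.

  (** ** Inductive definitions by finite sets *)

  (** Terms, formulas and values are defined by the same pattern: x has the property
      if it belongs to a finite set each of whose members is obtained by a step from
      members of the set.  For a monotone step this is a fixed point. *)

  Definition Wit (Step : (M -> Prop) -> M -> Prop) x :=
    exists b c d, Mem b c d x /\ forall y, Mem b c d y -> Step (Mem b c d) y.
  Definition mono (Step : (M -> Prop) -> M -> Prop) :=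
    forall P Q : M -> Prop, (forall y, P y -> Q y) -> forall x, Step P x -> Step Q x.

  Lemma Wit_inv Step x : mono Step -> Wit Step x -> Step (Wit Step) x.
  Proof.
    intros Hm (b & c & d & Hx & H). apply (Hm (Mem b c d)); [|now apply H].
    intros y Hy. exists b, c, d. auto.
  Qed.

  (** Finitely many witnessing sets can be united. *)
  Lemma Wit_list Step l : mono Step -> (forall y, In y l -> Wit Step y) ->
    exists b c d, (forall y, In y l -> Mem b c d y) /\
      forall y, Mem b c d y -> Step (Mem b c d) y.
  Proof.
    intros Hm. induction l as [|a l IH]; intros Hl.
    - destruct (comprehension (fun _ => False) DefP_False env0 zer) as (c & d & H).
      exists zer, c, d. split; [intros y []|]. intros y Hy. now apply H in Hy.
    - destruct IH as (b & c & d & H1 & H2); [intros y Hy; apply Hl; now right|].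
      destruct (Hl a) as (b' & c' & d' & H1' & H2'); [now left|].
      destruct (comprehension
        (fun rho => Mem (rho 1) (rho 2) (rho 3) (rho 0) \/ Mem (rho 4) (rho 5) (rho 6) (rho 0))
        ltac:(defp) (b .: c .: d .: b' .: c' .: d' .: env0) (b ⊞ b')) as (c'' & d'' & H).
      cbn in H.
      assert (Hun : forall y, Mem b c d y \/ Mem b' c' d' y -> Mem (b ⊞ b') c'' d'' y).
      { intros y Hy. apply H. split; [|exact Hy]. destruct Hy as [[Hy _]|[Hy _]];
          (eapply Le_trans; [exact Hy|]); [apply Le_add|apply Le_add_l]. }
      exists (b ⊞ b'), c'', d''. split.
      + intros y [<-|Hy]; apply Hun; auto.
      + intros y Hy. apply H in Hy as [_ [Hy|Hy]];
          [apply (Hm (Mem b c d)) | apply (Hm (Mem b' c' d'))]; auto.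
  Qed.

  Lemma Wit_intro Step l x : mono Step -> (forall y, In y l -> Wit Step y) ->
    Step (fun y => In y l) x -> Wit Step x.
  Proof.
    intros Hm Hl Hx. destruct (Wit_list Step l Hm Hl) as (b & c & d & H1 & H2).
    destruct (comprehension (fun rho => Mem (rho 1) (rho 2) (rho 3) (rho 0) \/ rho 0 = rho 4)
      ltac:(defp) (b .: c .: d .: x .: env0) (b ⊞ x)) as (c' & d' & H).
    cbn in H.
    assert (Hun : forall y, Mem b c d y -> Mem (b ⊞ x) c' d' y).
    { intros y Hy. apply H. split; [|auto]. eapply Le_trans; [apply Hy|apply Le_add]. }
    exists (b ⊞ x), c', d'. split.
    - apply H. split; [apply Le_add_l|auto].
    - intros y Hy. apply H in Hy as [_ [Hy| ->]].
      + apply (Hm (Mem b c d)); auto.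
      + apply (Hm (fun y => In y l)); auto.
  Qed.

  (** The same for binary relations, by sets of pairs. *)
  Definition Wit2 (Step : (M -> M -> Prop) -> M -> M -> Prop) j x :=
    exists b c d, Mem b c d (PR j x) /\
      forall i y, Mem b c d (PR i y) -> Step (fun i y => Mem b c d (PR i y)) i y.
  Definition mono2 (Step : (M -> M -> Prop) -> M -> M -> Prop) :=
    forall P Q : M -> M -> Prop, (forall i y, P i y -> Q i y) ->
    forall j x, Step P j x -> Step Q j x.
  Definition on_pairs (Step : (M -> M -> Prop) -> M -> M -> Prop) (P : M -> Prop) y :=
    forall i u, y = PR i u -> Step (fun i u => P (PR i u)) i u.

  Lemma Wit2_Wit Step j x : Wit2 Step j x <-> Wit (on_pairs Step) (PR j x).
  Proof.
    unfold Wit2, Wit, on_pairs. do 3 (apply ex_congr; intro). apply and_congr; [reflexivity|].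
    split; intros H; [intros y Hy i u ->; auto | intros i u Hi; now apply (H (PR i u))].
  Qed.
  Lemma on_pairs_mono Step : mono2 Step -> mono (on_pairs Step).
  Proof.
    intros Hm P Q H x Hx i u E. apply (Hm (fun i u => P (PR i u))); [auto|]. now apply Hx.
  Qed.
  Lemma Wit2_inv Step j x : mono2 Step -> Wit2 Step j x -> Step (Wit2 Step) j x.
  Proof.
    intros Hm H. apply Wit2_Wit in H. apply Wit_inv in H; [|now apply on_pairs_mono].
    specialize (H j x eq_refl). revert H. apply Hm. intros i y. apply Wit2_Wit.
  Qed.
  Lemma Wit2_intro Step l j x : mono2 Step -> (forall i y, In (i, y) l -> Wit2 Step i y) ->
    Step (fun i y => In (i, y) l) j x -> Wit2 Step j x.
  Proof.
    intros Hm Hl Hx. apply Wit2_Wit.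
    apply (Wit_intro _ (map (fun p => PR (fst p) (snd p)) l)); [now apply on_pairs_mono| |].
    - intros y Hy. apply in_map_iff in Hy as [[i u] [<- Hy]]. now apply Wit2_Wit, Hl.
    - intros i u E. apply PR_inj in E as [<- <-]. revert Hx. apply Hm. intros i y Hy.
      apply in_map_iff. now exists (i, y).
  Qed.

  (** ** Satisfaction of the formulas that define syntactic notions *)

  Section SatSyntax.
    Context (T : M -> Prop).

    Lemma sat_disj {X} (l : list X) (g : X -> form) rho : (forall f, In f l) ->
      (sat M T rho (disj (map g l)) <-> exists f, sat M T rho (g f)).
    Proof.
      intros Hl. transitivity (exists f, In f l /\ sat M T rho (g f)).
      - clear Hl. induction l as [|f l IH].
        + split; [|intros (f & [] & _)]. cbn. intros E. symmetry in E. now apply sc_zer in E.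
        + cbn [map disj fold_right]. rewrite sat_or. unfold disj in IH. rewrite IH. split.
          * intros [H|(f' & H1 & H2)]; [exists f|exists f']; cbn; auto.
          * intros (f' & [<-|H1] & H2); eauto.
      - apply ex_congr. intros f. specialize (Hl f). tauto.
    Qed.
    Lemma fn1s_all f : In f fn1s. Proof. destruct f; cbn; tauto. Qed.
    Lemma fn2s_all f : In f fn2s. Proof. destruct f; cbn; tauto. Qed.
    Lemma fn3s_all f : In f fn3s. Proof. destruct f; cbn; tauto. Qed.

    Lemma sat_lt rho s t : sat M T rho (lt s t) <-> Lt (eval M rho s) (eval M rho t).
    Proof.
      unfold lt. rewrite sat_ex. apply ex_congr. intros x. cbn. now rewrite !eval_lift.
    Qed.
    Lemma sat_mem rho x b c d : sat M T rho (mem x b c d) <->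
      Mem (eval M rho b) (eval M rho c) (eval M rho d) (eval M rho x).
    Proof.
      apply and_congr.
      - unfold le. rewrite sat_ex. apply ex_congr. intros y. cbn. now rewrite !eval_lift.
      - rewrite sat_ex. apply ex_congr. intros y. cbn. now rewrite !eval_lift.
    Qed.
    Lemma sat_inw rho n x : sat M T rho (inw n x) <->
      Mem (rho (n + 2)) (rho (n + 1)) (rho n) (eval M rho x).
    Proof. apply sat_mem. Qed.
  End SatSyntax.

  Ltac sat_step :=
    first
      [ rewrite sat_ex; apply ex_congr; intro
      | rewrite sat_or; apply or_congr
      | rewrite sat_imp; apply imp_congr
      | rewrite sat_disj by first [apply fn1s_all | apply fn2s_all | apply fn3s_all];
        apply ex_congr; intro
      | rewrite sat_inw
      | rewrite sat_lt
      | apply and_congr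
      | apply all_congr; intro ].
  Ltac sat_leaf := cbn [eval sat v pr cvar czero cap1 cap2 cap3 deq dtr dneg dand dall];
     rewrite ?eval_lift, ?eval_numeral; reflexivity.

  Definition TStep k (S : M -> Prop) u :=
    (exists i, Lt i k /\ u = CV i) \/
    u = CZ \/
    (exists f, exists s, u = C1 (nm (num1 f)) s /\ S s) \/
    (exists f, exists s t, u = C2 (nm (num2 f)) s t /\ S s /\ S t) \/
    (exists f, exists r s t, u = C3 (nm (num3 f)) r s t /\ S r /\ S s /\ S t).
  Definition IsTerm k x := Wit (TStep k) x.

  Lemma sat_isTerm T rho k x :
    sat M T rho (isTerm k x) <-> IsTerm (eval M rho k) (eval M rho x).
  Proof.
    unfold isTerm, IsTerm, Wit, term_step, TStep. repeat sat_step. all: sat_leaf.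
  Qed.

  Definition FStep (S : M -> M -> Prop) j u :=
    (exists s t, u = EQ s t /\ IsTerm j s /\ IsTerm j t) \/
    (exists t, u = TR t /\ IsTerm j t) \/
    (exists w, u = NEG w /\ S j w) \/
    (exists w w', u = AND w w' /\ S j w /\ S j w') \/
    (exists w, u = ALL w /\ S (sc j) w).
  Definition IsForm k x := Wit2 FStep k x.

  Lemma sat_isForm T rho k x :
    sat M T rho (isForm k x) <-> IsForm (eval M rho k) (eval M rho x).
  Proof.
    unfold isForm, IsForm, Wit2, form_step, FStep.
    repeat first [rewrite sat_isTerm | sat_step]. all: sat_leaf.
  Qed.

  Definition VStep (S : M -> M -> Prop) u y :=
    (u = CZ /\ y = zer) \/
    (exists f, exists s a, u = C1 (nm (num1 f)) s /\ S s a /\ y = i1 M f a) \/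
    (exists f, exists s t a b, u = C2 (nm (num2 f)) s t /\ S s a /\ S t b /\ y = i2 M f a b) \/
    (exists f, exists r s t a b c, u = C3 (nm (num3 f)) r s t /\
      S r a /\ S s b /\ S t c /\ y = i3 M f a b c).
  Definition IsVal x y := Wit2 VStep x y.

  Lemma sat_isVal T rho x y :
    sat M T rho (isVal x y) <-> IsVal (eval M rho x) (eval M rho y).
  Proof.
    unfold isVal, IsVal, Wit2, val_step, VStep. repeat sat_step. all: sat_leaf.
  Qed.

  (** ** Terms *)

  Lemma or_mono (A B A' B' : Prop) : (A -> A') -> (B -> B') -> A \/ B -> A' \/ B'.
  Proof. tauto. Qed.
  Lemma and_mono (A B A' B' : Prop) : (A -> A') -> (B -> B') -> A /\ B -> A' /\ B'.
  Proof. tauto. Qed.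
  Lemma ex_mono {X} (A B : X -> Prop) : (forall x, A x -> B x) ->
    (exists x, A x) -> exists x, B x.
  Proof. intros H [x Hx]. eauto. Qed.
  Ltac step_mono H :=
    repeat first [ exact (fun h => h) | apply H | apply or_mono | apply and_mono
                 | apply ex_mono; intro ].

  Lemma TStep_mono k : mono (TStep k).
  Proof. intros P Q H x. unfold TStep. step_mono H. Qed.

  Lemma DefP_IsTerm f g : DefT f -> DefT g -> DefP (fun rho => IsTerm (f rho) (g rho)).
  Proof.
    intros [t Ht] [s Hs]. exists (isTerm t s). intros rho. now rewrite sat_isTerm, Ht, Hs.
  Qed.
  Lemma DefP_IsForm f g : DefT f -> DefT g -> DefP (fun rho => IsForm (f rho) (g rho)).
  Proof.
    intros [t Ht] [s Hs]. exists (isForm t s). intros rho. now rewrite sat_isForm, Ht, Hs.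
  Qed.
  Lemma DefP_IsVal f g : DefT f -> DefT g -> DefP (fun rho => IsVal (f rho) (g rho)).
  Proof.
    intros [t Ht] [s Hs]. exists (isVal t s). intros rho. now rewrite sat_isVal, Ht, Hs.
  Qed.
  Lemma DefP_binary (P : M -> M -> Prop) f g : DefP (fun rho => P (rho 0) (rho 1)) ->
    DefT f -> DefT g -> DefP (fun rho => P (f rho) (g rho)).
  Proof.
    intros [A HA] Hf Hg. apply (DefP_formula _ A (f .: g .: fun _ _ => zer)).
    - intros rho. now rewrite <- HA.
    - intros [|[|n]]; cbn; [exact Hf|exact Hg|apply DefT_zero].
  Qed.
  Ltac defp_known ::=
    first
      [ apply DefP_Le | apply DefP_Lt | apply DefP_Mem
      | apply DefP_IsTerm | apply DefP_IsForm | apply DefP_IsVal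
      | match goal with H : DefP (fun rho => ?P (rho 0) (rho 1)) |- DefP (fun rho => ?P _ _) =>
          apply (DefP_binary P _ _ H) end ].

  Notation c1 f := (C1 (nm (num1 f))).
  Notation c2 f := (C2 (nm (num2 f))).
  Notation c3 f := (C3 (nm (num3 f))).

  Lemma IsTerm_inv k x : IsTerm k x -> TStep k (IsTerm k) x.
  Proof. apply Wit_inv, TStep_mono. Qed.
  Lemma IsTerm_intro l k x : (forall y, In y l -> IsTerm k y) ->
    TStep k (fun y => In y l) x -> IsTerm k x.
  Proof. apply Wit_intro, TStep_mono. Qed.

  Lemma IsTerm_CV k i : Lt i k -> IsTerm k (CV i).
  Proof. intros H. apply (IsTerm_intro []); [intros y []|]. left. eauto. Qed.
  Lemma IsTerm_CZ k : IsTerm k CZ.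
  Proof. apply (IsTerm_intro []); [intros y []|]. right. now left. Qed.
  Lemma IsTerm_c1 k f s : IsTerm k s -> IsTerm k (c1 f s).
  Proof.
    intros H. apply (IsTerm_intro [s]); [intros y [<-|[]]; auto|].
    right. right. left. exists f, s. cbn. auto.
  Qed.
  Lemma IsTerm_c2 k f s t : IsTerm k s -> IsTerm k t -> IsTerm k (c2 f s t).
  Proof.
    intros H1 H2. apply (IsTerm_intro [s; t]); [intros y [<-|[<-|[]]]; auto|].
    right. right. right. left. exists f, s, t. cbn. auto.
  Qed.
  Lemma IsTerm_c3 k f r s t : IsTerm k r -> IsTerm k s -> IsTerm k t -> IsTerm k (c3 f r s t).
  Proof.
    intros H1 H2 H3. apply (IsTerm_intro [r; s; t]); [intros y [<-|[<-|[<-|[]]]]; auto|].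
    right. right. right. right. exists f, r, s, t. cbn. auto 8.
  Qed.

  Lemma term_ind (P : M -> M -> Prop) : DefP (fun rho => P (rho 0) (rho 1)) ->
    (forall k i, Lt i k -> P k (CV i)) -> (forall k, P k CZ) ->
    (forall k f s, IsTerm k s -> P k s -> P k (c1 f s)) ->
    (forall k f s t, IsTerm k s -> P k s -> IsTerm k t -> P k t -> P k (c2 f s t)) ->
    (forall k f r s t, IsTerm k r -> P k r -> IsTerm k s -> P k s -> IsTerm k t -> P k t ->
      P k (c3 f r s t)) ->
    forall k x, IsTerm k x -> P k x.
  Proof.
    intros HP Hv Hz H1 H2 H3 k x. revert x k.
    apply (strong_ind (fun x => forall k, IsTerm k x -> P k x)); [defp|].
    intros x IH k Hx. apply IsTerm_inv in Hx.
    destruct Hx as [(i & Hi & ->)|[->|[(f & s & -> & Hs)|[(f & s & t & -> & Hs & Ht)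
      |(f & r & s & t & -> & Hr & Hs & Ht)]]]]; auto.
    - apply H1; auto. apply IH; auto. apply Lt_code_r. le_pr.
    - apply H2; auto; (apply IH; [apply Lt_code_r; le_pr | auto]).
    - apply H3; auto; (apply IH; [apply Lt_code_r; le_pr | auto]).
  Qed.

  Lemma IsTerm_weaken k x : IsTerm k x -> forall k', Le k k' -> IsTerm k' x.
  Proof.
    apply (term_ind (fun k x => forall k', Le k k' -> IsTerm k' x)); [defp| | | | |];
      intros; auto using IsTerm_CZ, IsTerm_c1, IsTerm_c2, IsTerm_c3.
    apply IsTerm_CV. eapply Lt_Le_trans; eauto.
  Qed.

  Definition Cterm x := IsTerm zer x.

  Lemma Cterm_IsTerm k x : Cterm x -> IsTerm k x.
  Proof. intros H. apply (IsTerm_weaken zer); [exact H|apply Le_0]. Qed.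

  (** ** Values of closed terms *)

  Lemma VStep_mono : mono2 VStep.
  Proof. intros P Q H x y. unfold VStep. step_mono H. Qed.

  Lemma IsVal_inv x y : IsVal x y -> VStep IsVal x y.
  Proof. apply Wit2_inv, VStep_mono. Qed.
  Lemma IsVal_intro l x y : (forall i y, In (i, y) l -> IsVal i y) ->
    VStep (fun i y => In (i, y) l) x y -> IsVal x y.
  Proof. apply Wit2_intro, VStep_mono. Qed.

  Ltac in_list := let E := fresh in
    intros ? ? E; cbn in E;
    repeat (destruct E as [E|E]; [injection E as <- <-; assumption|]); destruct E.

  Lemma IsVal_CZ : IsVal CZ zer.
  Proof. apply (IsVal_intro []); [in_list|]. left. auto. Qed.
  Lemma IsVal_c1 f s a : IsVal s a -> IsVal (c1 f s) (i1 M f a).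
  Proof.
    intros H. apply (IsVal_intro [(s, a)]); [in_list|].
    right. left. exists f, s, a. cbn. auto.
  Qed.
  Lemma IsVal_c2 f s t a b : IsVal s a -> IsVal t b -> IsVal (c2 f s t) (i2 M f a b).
  Proof.
    intros H1 H2. apply (IsVal_intro [(s, a); (t, b)]); [in_list|].
    right. right. left. exists f, s, t, a, b. cbn. auto 8.
  Qed.
  Lemma IsVal_c3 f r s t a b c : IsVal r a -> IsVal s b -> IsVal t c ->
    IsVal (c3 f r s t) (i3 M f a b c).
  Proof.
    intros H1 H2 H3. apply (IsVal_intro [(r, a); (s, b); (t, c)]); [in_list|].
    right. right. right. exists f, r, s, t, a, b, c. cbn. auto 12.
  Qed.

  Lemma IsVal_functional x y y' : IsVal x y -> IsVal x y' -> y = y'.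
  Proof.
    revert x y y'.
    apply (strong_ind (fun x => forall y y', IsVal x y -> IsVal x y' -> y = y')); [defp|].
    intros x IH y y' H H'. apply IsVal_inv in H, H'.
    destruct H as [[-> ->]|[(f & s & a & -> & Hs & ->)|[(f & s & t & a & b & -> & Hs & Ht & ->)
      |(f & r & s & t & a & b & c & -> & Hr & Hs & Ht & ->)]]];
    destruct H' as [[E ->]|[(f' & s' & a' & E & Hs' & ->)
      |[(f' & s' & t' & a' & b' & E & Hs' & Ht' & ->)
      |(f' & r' & s' & t' & a' & b' & c' & E & Hr' & Hs' & Ht' & ->)]]];
    codes; f_equal; auto; eapply IH; eauto; apply Lt_code_r; le_pr.
  Qed.

  Lemma IsVal_total x : Cterm x -> exists y, IsVal x y.
  Proof.
    intros H. refine (term_ind (fun k x => k = zer -> exists y, IsVal x y) _ _ _ _ _ _ zer x H eq_refl).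
    - defp.
    - intros k i Hi ->. now apply Lt_0 in Hi.
    - intros k _. exists zer. apply IsVal_CZ.
    - intros k f s _ IH E. destruct (IH E) as [a Ha]. exists (i1 M f a). now apply IsVal_c1.
    - intros k f s t _ IHs _ IHt E. destruct (IHs E) as [a Ha], (IHt E) as [b Hb].
      exists (i2 M f a b). now apply IsVal_c2.
    - intros k f r s t _ IHr _ IHs _ IHt E.
      destruct (IHr E) as [a Ha], (IHs E) as [b Hb], (IHt E) as [c Hc].
      exists (i3 M f a b c). now apply IsVal_c3.
  Qed.

  Lemma Cterm_NUM x : Cterm (NUM x).
  Proof.
    revert x. unfold Cterm. apply ind; [defp| |].
    - rewrite NUM_zer. apply IsTerm_CZ.
    - intros x IH. rewrite NUM_sc. now apply IsTerm_c1.
  Qed.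
  Lemma IsVal_NUM x : IsVal (NUM x) x.
  Proof.
    revert x. apply ind; [defp| |].
    - rewrite NUM_zer. apply IsVal_CZ.
    - intros x IH. rewrite NUM_sc. now apply IsVal_c1.
  Qed.

  (** ** Substitution in terms *)

  Lemma SUB_above k x : IsTerm k x -> forall j t, Le k j -> SUB j x t = x.
  Proof.
    revert k x. apply (term_ind (fun k x => forall j t, Le k j -> SUB j x t = x)).
    - defp.
    - intros k i Hi j t Hj. apply SUB_var_lt. eapply Lt_Le_trans; eauto.
    - intros. apply SUB_zero.
    - intros k f s _ IH j t Hj. now rewrite SUB_C1, IH.
    - intros k f s s' _ IH _ IH' j t Hj. now rewrite SUB_C2, IH, IH'.
    - intros k f r s s' _ IHr _ IH _ IH' j t Hj. now rewrite SUB_C3, IHr, IH, IH'.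
  Qed.
  Lemma SUB_closed x j t : Cterm x -> SUB j x t = x.
  Proof. intros H. apply (SUB_above zer); [exact H|apply Le_0]. Qed.

  (** The three cases in the definition of substitution for a variable. *)
  Lemma SUB_var_cases j i : Lt i j \/ i = j \/ exists i', i = sc i' /\ Le j i'.
  Proof.
    destruct (Lt_trichotomy i j) as [H|[H|H]]; auto. right. right.
    destruct (zer_or_sc i) as [->|[i' ->]]; [now apply Lt_0 in H|].
    exists i'. split; [reflexivity|]. now apply Lt_S.
  Qed.

  (** Substitution removes one free variable, as the indices above it are decremented. *)
  Lemma IsTerm_SUB k j x t : IsTerm (sc k) x -> Le j k -> Cterm t -> IsTerm k (SUB j x t).
  Proof.
    assert (K : forall k' x, IsTerm k' x -> forall k j t, k' = sc k -> Le j k ->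
      IsTerm zer t -> IsTerm k (SUB j x t)).
    2: { intros Hx Hj Ht. now apply (K (sc k)). }
    clear k j x t. refine (term_ind _ _ _ _ _ _ _).
    - defp.
    - intros k' i Hi k j t -> Hj Ht. apply Lt_S in Hi.
      destruct (SUB_var_cases j i) as [H|[->|(i' & -> & H)]].
      + rewrite SUB_var_lt by exact H. apply IsTerm_CV. eapply Lt_Le_trans; eauto.
      + rewrite SUB_var_eq. now apply Cterm_IsTerm.
      + rewrite SUB_var_gt by exact H. apply IsTerm_CV.
        eapply Lt_Le_trans; [apply Lt_S_diag|exact Hi].
    - intros. rewrite SUB_zero. apply IsTerm_CZ.
    - intros. rewrite SUB_C1. apply IsTerm_c1; eauto.
    - intros. rewrite SUB_C2. apply IsTerm_c2; eauto.
    - intros. rewrite SUB_C3. apply IsTerm_c3; eauto.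
  Qed.

  (** Instantiating index j + 1 before index j amounts to instantiating j first, after
      which the former j + 1 has become j; closed terms are not affected. *)
  Lemma SUB_SUB_term k x : IsTerm k x -> forall j s u, Cterm s -> Cterm u ->
    SUB j (SUB (sc j) x s) u = SUB j (SUB j x u) s.
  Proof.
    unfold Cterm. revert k x. apply (term_ind (fun k x => forall j s u, IsTerm zer s ->
      IsTerm zer u -> SUB j (SUB (sc j) x s) u = SUB j (SUB j x u) s)).
    - defp.
    - intros k i _ j s u Hs Hu.
      destruct (SUB_var_cases j i) as [H|[->|(i' & -> & H)]].
      + rewrite !(SUB_var_lt j i) by exact H. rewrite (SUB_var_lt (sc j) i).
        * now rewrite SUB_var_lt.
        * apply Lt_S. now apply Lt_Le.
      + rewrite SUB_var_lt by apply Lt_S_diag. rewrite !SUB_var_eq. now rewrite SUB_closed.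
      + rewrite (SUB_var_gt j i') by exact H. apply Le_cases in H as [->|H].
        * rewrite !SUB_var_eq. now apply SUB_closed.
        * destruct (zer_or_sc i') as [->|[i ->]]; [now apply Lt_0 in H|].
          apply Lt_S in H. rewrite (SUB_var_gt j i) by exact H.
          rewrite (SUB_var_gt (sc j)), SUB_var_gt; auto.
          destruct H as [z <-]. exists z. apply add_S_l.
    - intros. now rewrite !SUB_zero.
    - intros k f r _ IH j s u Hs Hu. now rewrite !SUB_C1, IH.
    - intros k f r r' _ IH _ IH' j s u Hs Hu. now rewrite !SUB_C2, IH, IH'.
    - intros k f r r' r'' _ IH _ IH' _ IH'' j s u Hs Hu. now rewrite !SUB_C3, IH, IH', IH''.
  Qed.

  Lemma IsVal_SUB x s t y : IsTerm one x -> IsVal s y -> IsVal t y ->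
    exists z, IsVal (SUB zer x s) z /\ IsVal (SUB zer x t) z.
  Proof.
    assert (K : forall k x, IsTerm k x -> k = sc zer -> forall s t y, IsVal s y -> IsVal t y ->
      exists z, IsVal (SUB zer x s) z /\ IsVal (SUB zer x t) z).
    2: { intros Hx. now apply (K one). }
    clear x s t y. refine (term_ind _ _ _ _ _ _ _).
    - defp.
    - intros k i Hi -> s t y Hs Ht. apply Lt_S, Le_cases in Hi as [->|Hi]; [|now apply Lt_0 in Hi].
      rewrite !SUB_var_eq. eauto.
    - intros k _ s t y _ _. rewrite !SUB_zero. eauto using IsVal_CZ.
    - intros k f r _ IH E s t y Hs Ht. destruct (IH E s t y Hs Ht) as (z & H1 & H2).
      rewrite !SUB_C1. eauto using IsVal_c1.
    - intros k f r r' _ IH _ IH' E s t y Hs Ht.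
      destruct (IH E s t y Hs Ht) as (z & H1 & H2), (IH' E s t y Hs Ht) as (z' & H1' & H2').
      rewrite !SUB_C2. eauto using IsVal_c2.
    - intros k f r r' r'' _ IH _ IH' _ IH'' E s t y Hs Ht.
      destruct (IH E s t y Hs Ht) as (z & H1 & H2), (IH' E s t y Hs Ht) as (z' & H1' & H2'),
        (IH'' E s t y Hs Ht) as (z'' & H1'' & H2'').
      rewrite !SUB_C3. eauto using IsVal_c3.
  Qed.

  (** ** Formulas *)

  Lemma FStep_mono : mono2 FStep.
  Proof. intros P Q H x y. unfold FStep. step_mono H. Qed.

  Lemma IsForm_inv k u : IsForm k u -> FStep IsForm k u.
  Proof. apply Wit2_inv, FStep_mono. Qed.
  Lemma IsForm_intro l k u : (forall j w, In (j, w) l -> IsForm j w) ->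
    FStep (fun j w => In (j, w) l) k u -> IsForm k u.
  Proof. apply Wit2_intro, FStep_mono. Qed.

  Lemma IsForm_EQ k s t : IsTerm k s -> IsTerm k t -> IsForm k (EQ s t).
  Proof. intros H1 H2. apply (IsForm_intro []); [in_list|]. left. eauto. Qed.
  Lemma IsForm_TR k t : IsTerm k t -> IsForm k (TR t).
  Proof. intros H. apply (IsForm_intro []); [in_list|]. right. left. eauto. Qed.
  Lemma IsForm_NEG k u : IsForm k u -> IsForm k (NEG u).
  Proof.
    intros H. apply (IsForm_intro [(k, u)]); [in_list|]. right. right. left.
    exists u. cbn. auto.
  Qed.
  Lemma IsForm_AND k u w : IsForm k u -> IsForm k w -> IsForm k (AND u w).
  Proof.
    intros H1 H2. apply (IsForm_intro [(k, u); (k, w)]); [in_list|]. right. right. right. left.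
    exists u, w. cbn. auto.
  Qed.
  Lemma IsForm_ALL k u : IsForm (sc k) u -> IsForm k (ALL u).
  Proof.
    intros H. apply (IsForm_intro [(sc k, u)]); [in_list|]. right. right. right. right.
    exists u. cbn. auto.
  Qed.

  Lemma form_ind (P : M -> M -> Prop) : DefP (fun rho => P (rho 0) (rho 1)) ->
    (forall k s t, IsTerm k s -> IsTerm k t -> P k (EQ s t)) ->
    (forall k t, IsTerm k t -> P k (TR t)) ->
    (forall k u, IsForm k u -> P k u -> P k (NEG u)) ->
    (forall k u w, IsForm k u -> P k u -> IsForm k w -> P k w -> P k (AND u w)) ->
    (forall k u, IsForm (sc k) u -> P (sc k) u -> P k (ALL u)) ->
    forall k u, IsForm k u -> P k u.
  Proof.
    intros HP He Ht Hn Ha Hq k u. revert u k.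
    apply (strong_ind (fun u => forall k, IsForm k u -> P k u)); [defp|].
    intros u IH k Hu. apply IsForm_inv in Hu.
    destruct Hu as [(s & t & -> & H1 & H2)|[(t & -> & H1)|[(w & -> & H1)
      |[(w & w' & -> & H1 & H2)|(w & -> & H1)]]]]; auto.
    - apply Hn; auto. apply IH; auto. rewrite NEG_code. apply Lt_code_r. le_pr.
    - apply Ha; auto; (apply IH; [rewrite AND_code; apply Lt_code_r; le_pr | auto]).
    - apply Hq; auto. apply IH; auto. rewrite ALL_code. apply Lt_code_r. le_pr.
  Qed.

  Lemma Le_S_S x y : Le x y -> Le (sc x) (sc y).
  Proof. intros [z <-]. exists z. apply add_S_l. Qed.

  Lemma IsForm_SUB k j u t : IsForm (sc k) u -> Le j k -> Cterm t -> IsForm k (SUB j u t).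
  Proof.
    assert (K : forall k' u, IsForm k' u -> forall k j t, k' = sc k -> Le j k ->
      IsTerm zer t -> IsForm k (SUB j u t)).
    2: { intros Hx Hj Ht. now apply (K (sc k)). }
    clear k j u t. refine (form_ind _ _ _ _ _ _ _).
    - defp.
    - intros k' s s' H1 H2 k j t -> Hj Ht. rewrite SUB_EQ. apply IsForm_EQ; now apply IsTerm_SUB.
    - intros k' s H1 k j t -> Hj Ht. rewrite SUB_TR. apply IsForm_TR; now apply IsTerm_SUB.
    - intros. rewrite SUB_NEG. apply IsForm_NEG; eauto.
    - intros. rewrite SUB_AND. apply IsForm_AND; eauto.
    - intros k' u _ IH k j t -> Hj Ht. rewrite SUB_ALL. apply IsForm_ALL.
      apply IH; auto. now apply Le_S_S.
  Qed.

  Lemma SUB_SUB_form k u : IsForm k u -> forall j s t, Cterm s -> Cterm t ->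
    SUB j (SUB (sc j) u s) t = SUB j (SUB j u t) s.
  Proof.
    unfold Cterm. revert k u. apply (form_ind (fun k u => forall j s t, IsTerm zer s ->
      IsTerm zer t -> SUB j (SUB (sc j) u s) t = SUB j (SUB j u t) s)).
    - defp.
    - intros k r r' H1 H2 j s t Hs Ht. rewrite !SUB_EQ. f_equal; eapply SUB_SUB_term; eauto.
    - intros k r H1 j s t Hs Ht. rewrite !SUB_TR. f_equal; eapply SUB_SUB_term; eauto.
    - intros k u _ IH j s t Hs Ht. rewrite !SUB_NEG. f_equal; auto.
    - intros k u w _ IH _ IH' j s t Hs Ht. rewrite !SUB_AND. f_equal; auto.
    - intros k u _ IH j s t Hs Ht. rewrite !SUB_ALL. f_equal; auto.
  Qed.

  (** ** Logical complexity *)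

  (** [Rank n u] says that n bounds the depth of the connectives and quantifiers of
      u, as witnessed by a finite set of pairs.  Unlike the code of u, this bound is
      preserved by substitution. *)

  Definition RStep (S : M -> M -> Prop) n u :=
    (exists s t, u = EQ s t) \/
    (exists t, u = TR t) \/
    (exists w m, u = NEG w /\ Lt m n /\ S m w) \/
    (exists w w' m m', u = AND w w' /\ Lt m n /\ Lt m' n /\ S m w /\ S m' w') \/
    (exists w m, u = ALL w /\ Lt m n /\ S m w).
  Definition Rank n u := Wit2 RStep n u.

  Lemma RStep_mono : mono2 RStep.
  Proof. intros P Q H x y. unfold RStep. step_mono H. Qed.
  Lemma Rank_inv n u : Rank n u -> RStep Rank n u.
  Proof. apply Wit2_inv, RStep_mono. Qed.
  Lemma Rank_intro l n u : (forall j w, In (j, w) l -> Rank j w) ->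
    RStep (fun j w => In (j, w) l) n u -> Rank n u.
  Proof. apply Wit2_intro, RStep_mono. Qed.
  Lemma DefP_Rank : DefP (fun rho => Rank (rho 0) (rho 1)).
  Proof. unfold Rank, Wit2, RStep, PR. defp. Qed.

  Lemma Rank_EQ n s t : Rank n (EQ s t).
  Proof. apply (Rank_intro []); [in_list|]. left. eauto. Qed.
  Lemma Rank_TR n t : Rank n (TR t).
  Proof. apply (Rank_intro []); [in_list|]. right. left. eauto. Qed.
  Lemma Rank_NEG m n u : Lt m n -> Rank m u -> Rank n (NEG u).
  Proof.
    intros Hm H. apply (Rank_intro [(m, u)]); [in_list|]. right. right. left.
    exists u, m. cbn. auto.
  Qed.
  Lemma Rank_AND m m' n u w : Lt m n -> Lt m' n -> Rank m u -> Rank m' w -> Rank n (AND u w).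
  Proof.
    intros Hm Hm' H1 H2. apply (Rank_intro [(m, u); (m', w)]); [in_list|].
    right. right. right. left. exists u, w, m, m'. cbn. auto 12.
  Qed.
  Lemma Rank_ALL m n u : Lt m n -> Rank m u -> Rank n (ALL u).
  Proof.
    intros Hm H. apply (Rank_intro [(m, u)]); [in_list|]. right. right. right. right.
    exists u, m. cbn. auto.
  Qed.

  Lemma Rank_ex k u : IsForm k u -> exists n, Rank n u.
  Proof.
    pose proof DefP_Rank as HR.
    apply (form_ind (fun k u => exists n, Rank n u)); [defp| | | | |].
    - intros _ s t _ _. exists zer. apply Rank_EQ.
    - intros _ t _. exists zer. apply Rank_TR.
    - intros _ w _ [n Hn]. exists (sc n). eapply Rank_NEG; eauto using Lt_S_diag.
    - intros _ w w' _ [n Hn] _ [n' Hn']. exists (sc (n ⊞ n')).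
      eapply Rank_AND; [| |exact Hn|exact Hn']; apply Lt_S; [apply Le_add|apply Le_add_l].
    - intros _ w _ [n Hn]. exists (sc n). eapply Rank_ALL; eauto using Lt_S_diag.
  Qed.

  Lemma Rank_SUB n u j t : Rank n u -> Rank n (SUB j u t).
  Proof.
    pose proof DefP_Rank as HR. revert n u j t.
    apply (strong_ind (fun n => forall u j t, Rank n u -> Rank n (SUB j u t))); [defp|].
    intros n IH u j t Hu. apply Rank_inv in Hu.
    destruct Hu as [(s & s' & ->)|[(s & ->)|[(w & m & -> & Hm & H1)
      |[(w & w' & m & m' & -> & Hm & Hm' & H1 & H2)|(w & m & -> & Hm & H1)]]]].
    - rewrite SUB_EQ. apply Rank_EQ.
    - rewrite SUB_TR. apply Rank_TR.
    - rewrite SUB_NEG. eapply Rank_NEG; eauto.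
    - rewrite SUB_AND. eapply Rank_AND; [exact Hm|exact Hm'| |]; auto.
    - rewrite SUB_ALL. eapply Rank_ALL; eauto.
  Qed.

  (** ** Codes of standard expressions *)

  (** The code in M of a standard term under m quantifiers, with the element sigma i
      of M in place of the code of variable m + i. *)
  Fixpoint qt (m : nat) (sigma : nat -> M) (t : term) : M :=
    match t with
    | Var i => if i <? m then CV (nm i) else sigma (i - m)
    | Zero => CZ
    | App1 f s => c1 f (qt m sigma s)
    | App2 f s1 s2 => c2 f (qt m sigma s1) (qt m sigma s2)
    | App3 f s1 s2 s3 => c3 f (qt m sigma s1) (qt m sigma s2) (qt m sigma s3)
    end.

  Fixpoint qf (m : nat) (sigma : nat -> M) (A : form) : M :=
    match A with
    | Equ s t => EQ (qt m sigma s) (qt m sigma t)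
    | Tru t => TR (qt m sigma t)
    | Not B => NEG (qf m sigma B)
    | And B C => AND (qf m sigma B) (qf m sigma C)
    | All B => ALL (qf (S m) sigma B)
    end.

  Lemma nm_code_term m sigma t : term_below m t -> nm (code_term t) = qt m sigma t.
  Proof.
    induction t; cbn [code_term qt term_below]; rewrite ?nm_pair; intros H.
    - apply Nat.ltb_lt in H. rewrite H. reflexivity.
    - reflexivity.
    - now rewrite IHt.
    - now rewrite IHt1, IHt2.
    - now rewrite IHt1, IHt2, IHt3.
  Qed.
  Lemma nm_code sigma A : forall m, form_below m A -> nm (code A) = qf m sigma A.
  Proof.
    induction A; intros m; cbn [code qf form_below];
      rewrite ?nm_pair, ?EQ_code, ?TR_code, ?NEG_code, ?AND_code, ?ALL_code; intros H.
    - destruct H. now rewrite !(nm_code_term m sigma).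
    - now rewrite (nm_code_term m sigma).
    - now rewrite (IHA m).
    - destruct H. now rewrite (IHA1 m), (IHA2 m).
    - now rewrite (IHA (S m)).
  Qed.

  (** The elements sigma i are codes of closed terms, so the substitution only affects
      the variable m itself. *)
  Lemma SUB_qt m sigma u t : (forall i, Cterm (sigma i)) ->
    SUB (nm m) (qt (S m) sigma t) u = qt m (u .: sigma) t.
  Proof.
    intros Hs. induction t; cbn [qt]; rewrite ?SUB_zero, ?SUB_C1, ?SUB_C2, ?SUB_C3; try congruence.
    destruct (Nat.ltb_spec n (S m)) as [H1|H1], (Nat.ltb_spec n m) as [H2|H2]; try lia.
    - apply SUB_var_lt. now apply nm_Lt.
    - replace n with m by lia. rewrite SUB_var_eq, Nat.sub_diag. reflexivity.
    - replace (n - m) with (S (n - S m)) by lia. apply SUB_closed, Hs.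
  Qed.
  Lemma SUB_qf sigma u A : (forall i, Cterm (sigma i)) -> forall m,
    SUB (nm m) (qf (S m) sigma A) u = qf m (u .: sigma) A.
  Proof.
    intros Hs. induction A; intros m; cbn [qf];
      rewrite ?SUB_EQ, ?SUB_TR, ?SUB_NEG, ?SUB_AND, ?SUB_ALL, ?SUB_qt; f_equal; auto.
    apply (IHA (S m)).
  Qed.
  Lemma IsTerm_qt m sigma t : (forall i, Cterm (sigma i)) -> IsTerm (nm m) (qt m sigma t).
  Proof.
    intros Hs. induction t; cbn [qt]; auto using IsTerm_CZ, IsTerm_c1, IsTerm_c2, IsTerm_c3.
    destruct (Nat.ltb_spec n m) as [H|H].
    - apply IsTerm_CV. now apply nm_Lt.
    - now apply Cterm_IsTerm.
  Qed.
  Lemma IsForm_qf sigma A : (forall i, Cterm (sigma i)) -> forall m, IsForm (nm m) (qf m sigma A).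
  Proof.
    intros Hs. induction A; intros m; cbn [qf].
    - apply IsForm_EQ; now apply IsTerm_qt.
    - apply IsForm_TR; now apply IsTerm_qt.
    - now apply IsForm_NEG.
    - now apply IsForm_AND.
    - apply IsForm_ALL. apply (IHA (S m)).
  Qed.
  Lemma IsVal_qt sigma rho t : (forall i, IsVal (sigma i) (rho i)) ->
    IsVal (qt 0 sigma t) (eval M rho t).
  Proof.
    intros Hs. induction t; cbn [qt eval]; auto using IsVal_CZ, IsVal_c1, IsVal_c2, IsVal_c3.
    cbn. now rewrite Nat.sub_0_r.
  Qed.

  Lemma SUB_code A t : form_below 1 A ->
    SUB zer (nm (code A)) t = qf 0 (t .: fun _ => CZ) A.
  Proof.
    intros HA. rewrite (nm_code (fun _ => CZ) A 1 HA).
    apply (SUB_qf _ t A (fun _ => IsTerm_CZ zer) 0).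
  Qed.

  (** ** Guarded quantifiers *)

  Definition EV s t := exists y, IsVal s y /\ IsVal t y.

  Lemma sat_AllC T rho A : sat M T rho (AllC A) <-> forall x, Cterm x -> sat M T (x .: rho) A.
  Proof.
    apply all_congr. intros x. rewrite sat_imp. unfold isCterm. rewrite sat_isTerm. reflexivity.
  Qed.
  Lemma sat_ExC T rho A : sat M T rho (ExC A) <-> exists x, Cterm x /\ sat M T (x .: rho) A.
  Proof.
    unfold ExC, isCterm. rewrite sat_ex. apply ex_congr. intros x. cbn [sat].
    rewrite sat_isTerm. reflexivity.
  Qed.
  Lemma sat_AllS T rho A :
    sat M T rho (AllS A) <-> forall x, IsForm zer x -> sat M T (x .: rho) A.
  Proof.
    apply all_congr. intros x. rewrite sat_imp. unfold isSent. rewrite sat_isForm. reflexivity.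
  Qed.
  Lemma sat_AllF T rho A :
    sat M T rho (AllF A) <-> forall x, IsForm one x -> sat M T (x .: rho) A.
  Proof.
    apply all_congr. intros x. rewrite sat_imp. unfold isForm1. rewrite sat_isForm. reflexivity.
  Qed.
  Lemma sat_eqval T rho s t : sat M T rho (eqval s t) <-> EV (eval M rho s) (eval M rho t).
  Proof.
    unfold eqval. rewrite sat_ex. apply ex_congr. intros x. cbn [sat].
    rewrite !sat_isVal, !eval_lift. reflexivity.
  Qed.
  Lemma sat_AllC2 T rho A : sat M T rho (AllC (AllC A)) <->
    forall s t, Cterm s -> Cterm t -> sat M T (t .: s .: rho) A.
  Proof.
    rewrite sat_AllC. setoid_rewrite sat_AllC. split; auto.
  Qed.
  Lemma sat_AllS2 T rho A : sat M T rho (AllS (AllS A)) <->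
    forall u w, IsForm zer u -> IsForm zer w -> sat M T (w .: u .: rho) A.
  Proof.
    rewrite sat_AllS. setoid_rewrite sat_AllS. split; auto.
  Qed.
  (** ** Truth of standard sentences *)

  Definition tau x := Tr (TR (NUM x)).

  (** What the axioms shared by the two theories say about M. *)
  Record compositional : Prop := {
    tr_sent : forall u, Tr u -> IsForm zer u;
    tr_eq : forall s t, Cterm s -> Cterm t -> (Tr (EQ s t) <-> EV s t);
    tr_neg : forall u, IsForm zer u -> (Tr (NEG u) <-> ~ Tr u);
    tr_and : forall u w, IsForm zer u -> IsForm zer w -> (Tr (AND u w) <-> Tr u /\ Tr w);
    tr_all : forall u, IsForm one u -> (Tr (ALL u) <-> forall t, Cterm t -> Tr (SUB zer u t));
    tr_reg : forall u s t, IsForm one u -> Cterm s -> Cterm t -> EV s t ->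
      (Tr (SUB zer u s) <-> Tr (SUB zer u t)) }.

  Lemma compositional_sat rho :
    (forall A, In A [Tsent; T1; T4; T5; T6; R1] -> sat M Tr rho A) -> compositional.
  Proof.
    intros H. cbn [In] in H. constructor.
    - intros u Hu. assert (K : sat M Tr rho Tsent) by (apply H; tauto).
      specialize (K u). rewrite sat_imp in K. unfold isSent in K. rewrite sat_isForm in K.
      exact (K Hu).
    - intros s t Hs Ht. assert (K : sat M Tr rho T1) by (apply H; tauto).
      unfold T1 in K. rewrite sat_AllC2 in K. specialize (K s t Hs Ht).
      rewrite sat_iff, sat_eqval in K. exact K.
    - intros u Hu. assert (K : sat M Tr rho T4) by (apply H; tauto).
      unfold T4 in K. rewrite sat_AllS in K. specialize (K u Hu).
      rewrite sat_iff in K. exact K.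
    - intros u w Hu Hw. assert (K : sat M Tr rho T5) by (apply H; tauto).
      unfold T5 in K. rewrite sat_AllS2 in K. specialize (K u w Hu Hw).
      rewrite sat_iff in K. exact K.
    - intros u Hu. assert (K : sat M Tr rho T6) by (apply H; tauto).
      unfold T6 in K. rewrite sat_AllF in K. specialize (K u Hu).
      rewrite sat_iff, sat_AllC in K. exact K.
    - intros u s t Hu Hs Ht Hst. assert (K : sat M Tr rho R1) by (apply H; tauto).
      unfold R1 in K. rewrite sat_AllF in K. specialize (K u Hu). rewrite sat_AllC2 in K.
      specialize (K s t Hs Ht). rewrite sat_imp, sat_iff, sat_eqval in K. exact (K Hst).
  Qed.

  Context (HC : compositional).

  Lemma EV_eq s t x y : IsVal s x -> IsVal t y -> (EV s t <-> x = y).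
  Proof.
    intros Hs Ht. split.
    - intros (z & H1 & H2). rewrite (IsVal_functional s x z Hs H1).
      now apply (IsVal_functional t).
    - intros <-. now exists x.
  Qed.

  (** R1 for the formula T(v), with the numeral of the value as the second term. *)
  Lemma tr_TR t y : Cterm t -> IsVal t y -> (Tr (TR t) <-> tau y).
  Proof.
    intros Ht Hv. unfold tau.
    pose proof (tr_reg HC (TR (CV zer)) t (NUM y)) as H.
    rewrite !SUB_TR, !SUB_var_eq in H. apply H.
    - apply IsForm_TR, IsTerm_CV, Lt_S_diag.
    - exact Ht.
    - apply Cterm_NUM.
    - exists y. split; [exact Hv|apply IsVal_NUM].
  Qed.

  (** T is a classical truth predicate for the structure in which T means [tau].  In
      the quantifier case closed terms and numbers match up, as every closed term has
      a value and every number has a numeral. *)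
  Lemma truth A : forall sigma rho, (forall i, Cterm (sigma i)) ->
    (forall i, IsVal (sigma i) (rho i)) -> (Tr (qf 0 sigma A) <-> sat M tau rho A).
  Proof.
    induction A; intros sigma rho Hs Hv; cbn [qf sat].
    - rewrite tr_eq; [|exact HC|now apply (IsTerm_qt 0)|now apply (IsTerm_qt 0)].
      apply EV_eq; now apply IsVal_qt.
    - apply tr_TR; [now apply (IsTerm_qt 0)|now apply IsVal_qt].
    - rewrite tr_neg; [|exact HC|now apply (IsForm_qf sigma A Hs 0)].
      now rewrite (IHA sigma rho).
    - rewrite tr_and; [|exact HC|now apply (IsForm_qf sigma A1 Hs 0)
        |now apply (IsForm_qf sigma A2 Hs 0)].
      now rewrite (IHA1 sigma rho), (IHA2 sigma rho).
    - rewrite tr_all; [|exact HC|now apply (IsForm_qf sigma A Hs 1)].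
      assert (K : forall t x, Cterm t -> IsVal t x ->
        (Tr (SUB zer (qf 1 sigma A) t) <-> sat M tau (x .: rho) A)).
      { intros t x Ht Hx. pose proof (SUB_qf sigma t A Hs 0) as E. cbn [nm] in E. rewrite E.
        apply IHA; intros [|i]; cbn; auto. }
      split; intros H.
      + intros x. apply (K (NUM x)); auto using Cterm_NUM, IsVal_NUM.
      + intros t Ht. destruct (IsVal_total t Ht) as [x Hx]. apply (K t x); auto.
  Qed.

  Lemma truth_dat A t x : form_below 1 A -> Cterm t -> IsVal t x ->
    (Tr (SUB zer (nm (code A)) t) <-> sat M tau (x .: env0) A).
  Proof.
    intros HA Ht Hx. rewrite SUB_code by exact HA.
    apply truth; intros [|i]; cbn; auto using IsVal_CZ. apply IsTerm_CZ.
  Qed.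

  (** ** The two theories in terms of the inner truth predicate *)

  Definition Dt x := tau x \/ tau (NEG x).
  (** The codes of the sentences F t and D t. *)
  Definition FC t := TR (c1 s_neg t).
  Definition DC t := SUB zer (nm (code (D (v 0)))) t.

  (** T7 to T15 and TDel in terms of [tau]. *)
  Record KF : Prop := {
    kf_eq : forall s t, Cterm s -> Cterm t -> (tau (EQ s t) <-> EV s t);
    kf_neq : forall s t, Cterm s -> Cterm t -> (tau (NEG (EQ s t)) <-> ~ EV s t);
    kf_dneg : forall u, IsForm zer u -> (tau u <-> tau (NEG (NEG u)));
    kf_and : forall u w, IsForm zer u -> IsForm zer w -> (tau (AND u w) <-> tau u /\ tau w);
    kf_nand : forall u w, IsForm zer u -> IsForm zer w ->
      (tau (NEG (AND u w)) <-> tau (NEG u) \/ tau (NEG w));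
    kf_all : forall u, IsForm one u -> (tau (ALL u) <-> forall t, Cterm t -> tau (SUB zer u t));
    kf_nall : forall u, IsForm one u ->
      (tau (NEG (ALL u)) <-> exists t, Cterm t /\ tau (NEG (SUB zer u t)));
    kf_tr : forall t x, Cterm t -> IsVal t x -> (tau (TR t) <-> tau x);
    kf_ntr : forall t x, Cterm t -> IsVal t x -> (tau (NEG (TR t)) <-> tau (NEG x));
    kf_del : forall x, tau x -> Tr x }.

  (** T2p, T3, D1 to D6 and R2 in terms of [tau]. *)
  Record CD : Prop := {
    cd_truth_D : forall x, Dt x <-> tau (TR (NUM x)) \/ tau (FC (NUM x));
    cd_out : forall x, Dt x -> (tau x <-> Tr x);
    cd_eq : forall s t, Cterm s -> Cterm t -> Dt (EQ s t);
    cd_tr : forall t x, Cterm t -> IsVal t x -> (Dt (TR t) <-> Dt x);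
    cd_D : forall t x, Cterm t -> IsVal t x -> (Dt (DC t) <-> Dt x);
    cd_neg : forall u, IsForm zer u -> (Dt (NEG u) <-> Dt u);
    cd_and : forall u w, IsForm zer u -> IsForm zer w -> (Dt (AND u w) <->
      (Dt u /\ Dt w) \/ (Dt u /\ Tr (NEG u)) \/ (Dt w /\ Tr (NEG w)));
    cd_all : forall u, IsForm one u -> (Dt (ALL u) <->
      (forall t, Cterm t -> Dt (SUB zer u t)) \/
      (exists t, Cterm t /\ Dt (SUB zer u t) /\ Tr (NEG (SUB zer u t))));
    cd_reg : forall u s t, IsForm one u -> Cterm s -> Cterm t -> EV s t ->
      (Dt (SUB zer u s) <-> Dt (SUB zer u t)) }.

  Lemma below_numeral n k : term_below n (numeral k).
  Proof. induction k; cbn; auto. Qed.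

  Lemma below_D n x : term_below n x -> form_below n (D x).
  Proof.
    intros H. unfold D, Or, TT, TF, TTc, TFc, dF, dat, dtr, num, dsub.
    cbn [form_below term_below]. auto 10 using below_numeral.
  Qed.

  Lemma dF_code t : SUB zer (nm (code (Fls (v 0)))) t = FC t.
  Proof. rewrite SUB_code by (cbn; lia). reflexivity. Qed.

  Lemma SUB_Form1 u t : IsForm one u -> Cterm t -> IsForm zer (SUB zer u t).
  Proof. intros Hu Ht. apply IsForm_SUB; auto. apply Le_refl. Qed.

  (** D t is a disjunction of two atoms, which state the truth of T x and of F x for the
      value x of t. *)
  Lemma DC_code t x : Cterm t -> IsVal t x -> exists a b, DC t = NEG (AND (NEG (TR a)) (NEG (TR b)))
    /\ Cterm a /\ Cterm b /\ IsVal a (TR (NUM x)) /\ IsVal b (FC (NUM x)).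
  Proof.
    intros Ht Hx. unfold DC. rewrite SUB_code by (apply below_D; cbn; lia).
    set (sigma := t .: fun _ => CZ). set (rho := x .: fun _ => zer).
    assert (Hs : forall i, Cterm (sigma i)).
    { intros [|i]; cbn; [exact Ht|apply IsTerm_CZ]. }
    assert (Hv : forall i, IsVal (sigma i) (rho i)).
    { intros [|i]; cbn; [exact Hx|apply IsVal_CZ]. }
    exists (qt 0 sigma (dtr (num (v 0)))), (qt 0 sigma (dF (num (v 0)))).
    split; [reflexivity|]. split; [now apply (IsTerm_qt 0)|]. split; [now apply (IsTerm_qt 0)|].
    split.
    - now apply (IsVal_qt sigma rho (dtr (num (v 0)))).
    - assert (E : eval M rho (dF (num (v 0))) = FC (NUM x)).
      { unfold dF, dat, dsub. cbn [eval]. rewrite eval_numeral. apply dF_code. }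
      rewrite <- E. now apply IsVal_qt.
  Qed.

  (** Replacing terms by terms with the same value does not affect inner truth.  The
      instances of a universal formula may have larger codes, so the induction is on
      complexity, which substitution preserves. *)
  Lemma kf_reg (K : KF) n u s t : Rank n u -> IsForm one u -> Cterm s -> Cterm t -> EV s t ->
    (tau (SUB zer u s) <-> tau (SUB zer u t)) /\
    (tau (NEG (SUB zer u s)) <-> tau (NEG (SUB zer u t))).
  Proof.
    pose proof DefP_Rank as HR. unfold Cterm, one, EV, tau. revert n u s t.
    apply (strong_ind (fun n => forall u s t, Rank n u -> IsForm (sc zer) u ->
      IsTerm zer s -> IsTerm zer t -> (exists y, IsVal s y /\ IsVal t y) ->
      (Tr (TR (NUM (SUB zer u s))) <-> Tr (TR (NUM (SUB zer u t)))) /\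
      (Tr (TR (NUM (NEG (SUB zer u s)))) <-> Tr (TR (NUM (NEG (SUB zer u t)))))));
      [defp|].
    fold one. intros n IH u s t Hn Hu Hs Ht Hst. fold (EV s t) in Hst.
    repeat match goal with |- context [Tr (TR (NUM ?x))] => fold (tau x) end.
    assert (Hval : forall r, IsTerm one r -> exists z, Cterm (SUB zer r s) /\
      Cterm (SUB zer r t) /\ IsVal (SUB zer r s) z /\ IsVal (SUB zer r t) z).
    { intros r Hr. destruct Hst as (y & Hy & Hy').
      destruct (IsVal_SUB r s t y Hr Hy Hy') as (z & Hz & Hz'). exists z.
      split; [|split]; auto; apply IsTerm_SUB; auto using Le_refl. }
    assert (IH' : forall m w, Lt m n -> Rank m w -> IsForm one w ->
      (tau (SUB zer w s) <-> tau (SUB zer w t)) /\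
      (tau (NEG (SUB zer w s)) <-> tau (NEG (SUB zer w t)))).
    { intros m w Hm Hmw Hw. now apply (IH m). }
    apply IsForm_inv in Hu. apply Rank_inv in Hn.
    destruct Hu as [(r & r' & -> & H1 & H2)|[(r & -> & H1)|[(w & -> & H1)
      |[(w & w' & -> & H1 & H2)|(w & -> & H1)]]]].
    - rewrite !SUB_EQ. destruct (Hval r H1) as (z & Hc1 & Hc2 & Hz & Hz'),
        (Hval r' H2) as (z' & Hc1' & Hc2' & Hz1 & Hz1').
      rewrite !(kf_eq K), !(kf_neq K) by assumption.
      rewrite !(EV_eq _ _ z z') by assumption. tauto.
    - rewrite !SUB_TR. destruct (Hval r H1) as (z & Hc1 & Hc2 & Hz & Hz').
      rewrite !(kf_tr K _ z), !(kf_ntr K _ z) by assumption. tauto.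
    - assert (Hw : exists m, Lt m n /\ Rank m w).
      { destruct Hn as [(? & ? & E)|[(? & E)|[(? & m & E & ? & ?)
          |[(? & ? & ? & ? & E & ?)|(? & ? & E & ?)]]]]; codes. eauto. }
      destruct Hw as (m & Hm & Hw). destruct (IH' m w Hm Hw H1) as [I1 I2].
      rewrite !SUB_NEG, <- !(kf_dneg K) by (apply SUB_Form1; assumption). tauto.
    - assert (Hw : exists m m', Lt m n /\ Lt m' n /\ Rank m w /\ Rank m' w').
      { destruct Hn as [(? & ? & E)|[(? & E)|[(? & ? & E & ? & ?)
          |[(? & ? & m & m' & E & ? & ? & ? & ?)|(? & ? & E & ?)]]]]; codes. eauto 6. }
      destruct Hw as (m & m' & Hm & Hm' & Hw & Hw').
      destruct (IH' m w Hm Hw H1) as [I1 I2], (IH' m' w' Hm' Hw' H2) as [I1' I2'].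
      rewrite !SUB_AND, !(kf_and K), !(kf_nand K) by (apply SUB_Form1; assumption). tauto.
    - assert (Hw : exists m, Lt m n /\ Rank m w).
      { destruct Hn as [(? & ? & E)|[(? & E)|[(? & ? & E & ?)
          |[(? & ? & ? & ? & E & ?)|(? & m & E & ? & ?)]]]]; codes. eauto. }
      destruct Hw as (m & Hm & Hw). fold one in H1 |- *.
      assert (I : forall r, Cterm r ->
        (tau (SUB zer (SUB one w s) r) <-> tau (SUB zer (SUB one w t) r)) /\
        (tau (NEG (SUB zer (SUB one w s) r)) <-> tau (NEG (SUB zer (SUB one w t) r)))).
      { intros r Hr. unfold one.
        rewrite !(SUB_SUB_form (sc one) w) by assumption.
        apply (IH' m); [exact Hm|now apply Rank_SUB|].
        apply IsForm_SUB; auto using Le_0. }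
      assert (Hb : forall r, Cterm r -> IsForm one (SUB one w r)).
      { intros r Hr. apply IsForm_SUB; auto using Le_refl. }
      rewrite !SUB_ALL. fold one.
      rewrite !(kf_all K), !(kf_nall K) by auto.
      split; split.
      + intros H r Hr. now apply I, H.
      + intros H r Hr. now apply I, H.
      + intros (r & Hr & H). exists r. split; [exact Hr|]. now apply I.
      + intros (r & Hr & H). exists r. split; [exact Hr|]. now apply I.
  Qed.

  Lemma FC_val x : IsVal (c1 s_neg (NUM x)) (NEG x).
  Proof. apply (IsVal_c1 s_neg), IsVal_NUM. Qed.
  Lemma FC_closed x : Cterm (c1 s_neg (NUM x)).
  Proof. apply IsTerm_c1, Cterm_NUM. Qed.

  (** By [kf_del] and T4 a sentence and its negation are never both in tau.  This gives the
      implications from determinateness to the classical clauses, and the clauses for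
      D are then instances of the strong Kleene clauses. *)
  Lemma KF_CD : KF -> CD.
  Proof.
    intros K.
    constructor.
    - intros x. unfold FC.
      rewrite (kf_tr K (NUM x) x) by auto using Cterm_NUM, IsVal_NUM.
      rewrite (kf_tr K (c1 s_neg (NUM x)) (NEG x)) by auto using FC_closed, FC_val.
      reflexivity.
    - intros x Hx. split; [apply (kf_del K)|]. intros H.
      destruct Hx as [Hx|Hx]; [exact Hx|]. apply (kf_del K), (tr_neg HC) in Hx; [contradiction|].
      now apply (tr_sent HC).
    - intros s t Hs Ht. unfold Dt. rewrite (kf_eq K), (kf_neq K) by assumption. apply classic.
    - intros t x Ht Hx. unfold Dt. rewrite (kf_tr K t x), (kf_ntr K t x) by assumption. tauto.
    - intros t x Ht Hx. destruct (DC_code t x Ht Hx) as (a & b & -> & Ha & Hb & Va & Vb).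
      assert (Fa : IsForm zer (TR a)) by now apply IsForm_TR.
      assert (Fb : IsForm zer (TR b)) by now apply IsForm_TR.
      unfold Dt. rewrite <- (kf_dneg K) by auto using IsForm_AND, IsForm_NEG.
      rewrite (kf_nand K), (kf_and K), <- !(kf_dneg K) by auto using IsForm_NEG.
      rewrite (kf_tr K a _ Ha Va), (kf_tr K b _ Hb Vb).
      rewrite (kf_ntr K a _ Ha Va). unfold FC at 1.
      rewrite (kf_tr K (NUM x) x) by auto using Cterm_NUM, IsVal_NUM.
      rewrite (kf_ntr K (NUM x) x) by auto using Cterm_NUM, IsVal_NUM.
      rewrite (kf_tr K (c1 s_neg (NUM x)) (NEG x)) by auto using FC_closed, FC_val.
      tauto.
    - intros u Hu. unfold Dt. rewrite <- (kf_dneg K) by assumption. tauto.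
    - intros u w Hu Hw. unfold Dt. rewrite (kf_and K), (kf_nand K) by assumption. split.
      + intros [H|[H|H]]; [tauto| |]; pose proof (kf_del K _ H); tauto.
      + intros [H|[[H1 H2]|[H1 H2]]]; [tauto| |]; apply (tr_neg HC) in H2; auto;
          pose proof (kf_del K u); pose proof (kf_del K w); tauto.
    - intros u Hu. unfold Dt. rewrite (kf_all K), (kf_nall K) by assumption. split.
      + intros [H|(t & Ht & H)]; [left; auto|]. right. exists t.
        pose proof (kf_del K _ H). tauto.
      + intros [H|(t & Ht & [H1|H1] & H2)].
        * destruct (classic (exists t, Cterm t /\ tau (NEG (SUB zer u t)))) as [H'|H']; [auto|].
          left. intros t Ht. destruct (H t Ht); [assumption|]. exfalso. eauto.
        * apply (kf_del K) in H1. apply (tr_neg HC) in H2; [contradiction|]. now apply SUB_Form1.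
        * right. eauto.
    - intros u s t Hu Hs Ht Hst. destruct (Rank_ex one u Hu) as [n Hn].
      destruct (kf_reg K n u s t) as [H1 H2]; auto. unfold Dt. tauto.
  Qed.

  (** A sentence is in tau if and only if it is determinate and true, and its negation is
      in tau if and only if it is determinate and not true.  The clauses for tau follow
      from those for D and for T. *)
  Lemma CD_KF : CD -> KF.
  Proof.
    intros K.
    assert (Hout : forall x, tau x -> Tr x).
    { intros x H. apply (cd_out K); [now left|exact H]. }
    (* on determinate sentences inner truth is truth *)
    assert (Hin : forall x, Dt x -> Tr x -> tau x).
    { intros x H1 H2. now apply (cd_out K). }
    assert (Hneg : forall x, IsForm zer x -> tau (NEG x) -> Dt x /\ ~ Tr x).
    { intros x Hx H. split; [now right|]. apply (tr_neg HC x Hx). now apply Hout. }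
    assert (Hneg' : forall x, IsForm zer x -> Dt x -> ~ Tr x -> tau (NEG x)).
    { intros x Hx H1 H2. apply Hin; [now apply (cd_neg K)|]. now apply (tr_neg HC). }
    constructor.
    - intros s t Hs Ht. rewrite <- (tr_eq HC) by assumption.
      apply (cd_out K). now apply (cd_eq K).
    - intros s t Hs Ht. assert (F : IsForm zer (EQ s t)) by now apply IsForm_EQ.
      rewrite <- (tr_eq HC), <- (tr_neg HC) by assumption.
      apply (cd_out K), (cd_neg K); [assumption|]. now apply (cd_eq K).
    - intros u Hu. assert (Hn : IsForm zer (NEG u)) by now apply IsForm_NEG. split; intros H.
      + apply Hneg'; [assumption|apply (cd_neg K); auto; now left|].
        rewrite (tr_neg HC) by assumption. intros H'. apply H', Hout, H.
      + apply Hneg in H as [H1 H2]; [|assumption]. rewrite (cd_neg K) in H1 by assumption.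
        apply Hin; [assumption|]. rewrite (tr_neg HC) in H2 by assumption. tauto.
    - intros u w Hu Hw. split.
      + intros H. assert (HD : Dt (AND u w)) by now left. apply Hout in H.
        apply (tr_and HC) in H as [H1 H2]; [|assumption..].
        apply (cd_and K) in HD; [|assumption..]. rewrite !(tr_neg HC) in HD by assumption.
        split; apply Hin; tauto.
      + intros [H1 H2]. apply Hin.
        * apply (cd_and K); [assumption..|]. left. split; now left.
        * apply (tr_and HC); auto.
    - intros u w Hu Hw. assert (F : IsForm zer (AND u w)) by now apply IsForm_AND. split.
      + intros H. apply Hneg in H as [H1 H2]; [|assumption].
        rewrite (tr_and HC) in H2 by assumption.
        apply (cd_and K) in H1; [|assumption..].
        pose proof (Hneg' u Hu). pose proof (Hneg' w Hw).
        rewrite !(tr_neg HC) in H1 by assumption. tauto.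
      + intros H. apply Hneg'; [assumption| |].
        * apply (cd_and K); [assumption..|]. right.
          destruct H as [H|H]; [left|right]; split; auto; now right.
        * rewrite (tr_and HC) by assumption.
          destruct H as [H|H]; apply Hneg in H; tauto.
    - intros u Hu. assert (F : forall t, Cterm t -> IsForm zer (SUB zer u t)).
      { intros t Ht. now apply SUB_Form1. }
      split.
      + intros H t Ht. assert (HD : Dt (ALL u)) by now left. apply Hout in H.
        rewrite (tr_all HC) in H by assumption.
        apply (cd_all K) in HD as [HD|(r & Hr & _ & HD)]; [|exfalso|assumption].
        * apply Hin; auto.
        * apply (tr_neg HC) in HD; auto.
      + intros H. apply Hin.
        * apply (cd_all K); [assumption|]. left. intros t Ht. left. auto.
        * apply (tr_all HC); [assumption|]. auto.
    - intros u Hu. assert (F : forall t, Cterm t -> IsForm zer (SUB zer u t)).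
      { intros t Ht. now apply SUB_Form1. }
      assert (F' : IsForm zer (ALL u)) by now apply IsForm_ALL.
      split.
      + intros H. apply Hneg in H as [H1 H2]; [|assumption].
        rewrite (tr_all HC) in H2 by assumption.
        apply (cd_all K) in H1 as [H1|(r & Hr & H1 & H3)]; [| |assumption].
        * apply not_all_ex_not in H2 as [t Ht]. apply imply_to_and in Ht as [Ht H2].
          exists t. auto.
        * exists r. split; [exact Hr|]. apply (tr_neg HC) in H3; auto.
      + intros (t & Ht & H). apply Hneg'; [assumption| |].
        * apply (cd_all K); [assumption|]. right. exists t. split; [exact Ht|].
          split; [now right|auto].
        * rewrite (tr_all HC) by assumption. intros H'. apply Hneg in H; auto.
          now apply H, H'.
    - intros t x Ht Hx. rewrite <- (tr_TR t x) by assumption.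
      split; [apply Hout|]. intros H. apply Hin; [|exact H].
      apply (cd_tr K t x); [assumption..|]. left. now apply (tr_TR t x).
    - intros t x Ht Hx. assert (F : IsForm zer (TR t)) by now apply IsForm_TR. split.
      + intros H. apply Hneg in H as [H1 H2]; [|assumption].
        apply (cd_tr K t x) in H1; [|assumption..].
        rewrite (tr_TR t x) in H2 by assumption. destruct H1; tauto.
      + intros H. apply Hneg'; [assumption| |].
        * apply (cd_tr K t x); [assumption..|]. now right.
        * rewrite (tr_TR t x) by assumption. intros H'.
          apply Hneg in H; [|apply (tr_sent HC)]; auto. now apply H, Hout.
    - exact Hout.
  Qed.

  (** ** The axioms *)

  Lemma sat_Tval rho t :
    sat M Tr rho (Tval t) <-> exists x, IsVal (eval M rho t) x /\ Tr x.
  Proof.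
    unfold Tval. rewrite sat_ex. apply ex_congr. intros x. cbn [sat].
    rewrite !sat_isVal, !eval_lift. reflexivity.
  Qed.
  Lemma sat_TFc rho t : sat M Tr rho (TFc t) <-> Tr (FC (eval M rho t)).
  Proof.
    unfold TFc, dF, dat, dsub. cbn [sat eval]. rewrite eval_numeral, dF_code. reflexivity.
  Qed.
  Lemma sat_TF rho x : sat M Tr rho (TF x) <-> tau (NEG (eval M rho x)).
  Proof. unfold TF. rewrite sat_TFc. apply tr_TR; [apply FC_closed|apply FC_val]. Qed.
  Lemma sat_D rho x : sat M Tr rho (D x) <-> Dt (eval M rho x).
  Proof. unfold D. rewrite sat_or, sat_TF. reflexivity. Qed.
  Lemma sat_D_tau rho x :
    sat M tau rho (D x) <-> tau (TR (NUM (eval M rho x))) \/ tau (FC (NUM (eval M rho x))).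
  Proof.
    unfold D. rewrite sat_or. apply or_congr; [reflexivity|].
    unfold TF, TFc, dF, dat, dsub. cbn [sat eval]. rewrite eval_numeral.
    change (eval M rho (num x)) with (NUM (eval M rho x)). rewrite dF_code. reflexivity.
  Qed.
  Lemma sat_Dval rho t :
    sat M Tr rho (Dval t) <-> exists x, IsVal (eval M rho t) x /\ Dt x.
  Proof.
    unfold Dval. rewrite sat_ex. apply ex_congr. intros x. cbn [sat].
    rewrite sat_isVal, sat_D, eval_lift. reflexivity.
  Qed.
  Lemma sat_dat rho A t x : form_below 1 A -> Cterm (eval M rho t) -> IsVal (eval M rho t) x ->
    (sat M Tr rho (Tru (dat A t)) <-> sat M tau (x .: env0) A).
  Proof.
    intros HA Ht Hx. rewrite <- (truth_dat A (eval M rho t) x HA Ht Hx).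
    unfold dat, dsub. cbn [sat eval]. rewrite eval_numeral. reflexivity.
  Qed.

  Lemma value_iff t x (P : M -> Prop) : IsVal t x -> ((exists y, IsVal t y /\ P y) <-> P x).
  Proof.
    intros Hx. split; [|eauto]. intros (y & Hy & H). now rewrite (IsVal_functional t x y).
  Qed.

  Lemma sat_AllC_value rho A (P : M -> M -> Prop) :
    (forall t x, Cterm t -> IsVal t x -> (sat M Tr (t .: rho) A <-> P t x)) ->
    (sat M Tr rho (AllC A) <-> forall t x, Cterm t -> IsVal t x -> P t x).
  Proof.
    intros H. rewrite sat_AllC. split.
    - intros K t x Ht Hx. apply H; auto.
    - intros K t Ht. destruct (IsVal_total t Ht) as [x Hx]. apply (H t x); auto.
  Qed.
  Lemma sat_AllC_number rho A (P : M -> Prop) :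
    (forall t x, Cterm t -> IsVal t x -> (sat M Tr (t .: rho) A <-> P x)) ->
    (sat M Tr rho (AllC A) <-> forall x, P x).
  Proof.
    intros H. rewrite (sat_AllC_value rho A (fun _ => P)) by exact H. split; auto.
    intros K x. exact (K (NUM x) x (Cterm_NUM x) (IsVal_NUM x)).
  Qed.

  Lemma sat_T7 rho : sat M Tr rho T7 <->
    forall s t, Cterm s -> Cterm t -> (tau (EQ s t) <-> EV s t).
  Proof.
    unfold T7. rewrite sat_AllC2. do 4 (apply all_congr; intro).
    rewrite sat_iff, sat_eqval. reflexivity.
  Qed.
  Lemma sat_T8 rho : sat M Tr rho T8 <->
    forall s t, Cterm s -> Cterm t -> (tau (NEG (EQ s t)) <-> ~ EV s t).
  Proof.
    unfold T8. rewrite sat_AllC2. do 4 (apply all_congr; intro).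
    rewrite sat_iff, sat_TF. cbn [sat]. rewrite sat_eqval. reflexivity.
  Qed.
  Lemma sat_T9 rho : sat M Tr rho T9 <->
    forall u, IsForm zer u -> (tau u <-> tau (NEG (NEG u))).
  Proof.
    unfold T9. rewrite sat_AllS. do 2 (apply all_congr; intro). rewrite sat_iff. reflexivity.
  Qed.
  Lemma sat_T10 rho : sat M Tr rho T10 <->
    forall u w, IsForm zer u -> IsForm zer w -> (tau (AND u w) <-> tau u /\ tau w).
  Proof.
    unfold T10. rewrite sat_AllS2. do 4 (apply all_congr; intro). rewrite sat_iff. reflexivity.
  Qed.
  Lemma sat_T11 rho : sat M Tr rho T11 <->
    forall u w, IsForm zer u -> IsForm zer w ->
      (tau (NEG (AND u w)) <-> tau (NEG u) \/ tau (NEG w)).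
  Proof.
    unfold T11. rewrite sat_AllS2. do 4 (apply all_congr; intro).
    rewrite sat_iff, sat_or, !sat_TF. reflexivity.
  Qed.
  Lemma sat_T12 rho : form_below 1 (AllC (Tru (at_ (v 1) (v 0)))) -> sat M Tr rho T12 <->
    forall u, IsForm one u -> (tau (ALL u) <-> forall t, Cterm t -> tau (SUB zer u t)).
  Proof.
    intros HA. unfold T12. rewrite sat_AllF. apply all_congr. intros u. apply all_congr. intros Hu.
    rewrite sat_iff, (sat_dat (u .: rho) _ (num (v 0)) u HA (Cterm_NUM u) (IsVal_NUM u)), sat_AllC. reflexivity.
  Qed.
  Lemma sat_T13 rho : form_below 1 (ExC (Fls (at_ (v 1) (v 0)))) -> sat M Tr rho T13 <->
    forall u, IsForm one u ->
      (tau (NEG (ALL u)) <-> exists t, Cterm t /\ tau (NEG (SUB zer u t))).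
  Proof.
    intros HA. unfold T13. rewrite sat_AllF. apply all_congr. intros u. apply all_congr. intros Hu.
    rewrite sat_iff, (sat_dat (u .: rho) _ (num (v 0)) u HA (Cterm_NUM u) (IsVal_NUM u)), sat_ExC, sat_TF.
    reflexivity.
  Qed.
  Lemma sat_T14 rho : sat M Tr rho T14 <->
    forall t x, Cterm t -> IsVal t x -> (tau (TR t) <-> tau x).
  Proof.
    apply sat_AllC_value. intros t x Ht Hx. rewrite sat_iff, <- (tr_TR t x Ht Hx). reflexivity.
  Qed.
  Lemma tr_FC t x : Cterm t -> IsVal t x -> (Tr (FC t) <-> tau (NEG x)).
  Proof. intros Ht Hx. apply tr_TR; [now apply IsTerm_c1|now apply (IsVal_c1 s_neg)]. Qed.
  Lemma sat_T15 rho : sat M Tr rho T15 <->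
    forall t x, Cterm t -> IsVal t x -> (tau (NEG (TR t)) <-> tau (NEG x)).
  Proof.
    apply sat_AllC_value. intros t x Ht Hx.
    rewrite sat_iff, sat_TF, sat_TFc, <- (tr_FC t x Ht Hx). reflexivity.
  Qed.
  Lemma sat_TDel rho : sat M Tr rho TDel <-> forall x, tau x -> Tr x.
  Proof.
    apply sat_AllC_number. intros t x Ht Hx.
    rewrite sat_imp, sat_Tval, value_iff by exact Hx. rewrite <- (tr_TR t x Ht Hx). reflexivity.
  Qed.

  Lemma sat_T2p rho : sat M Tr rho T2p <->
    forall x, Dt x <-> tau (TR (NUM x)) \/ tau (FC (NUM x)).
  Proof.
    apply sat_AllC_number. intros t x Ht Hx.
    rewrite sat_iff, sat_Dval, value_iff by exact Hx.
    unfold dD. rewrite (sat_dat _ _ _ x) by (assumption || (apply below_D; cbn; lia)).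
    rewrite sat_D_tau. reflexivity.
  Qed.
  Lemma sat_T3 rho : sat M Tr rho T3 <-> forall x, Dt x -> (tau x <-> Tr x).
  Proof.
    apply sat_AllC_number. intros t x Ht Hx.
    rewrite sat_imp, sat_iff, sat_Dval, sat_Tval, !value_iff by exact Hx.
    rewrite <- (tr_TR t x Ht Hx). reflexivity.
  Qed.
  Lemma sat_D1 rho : sat M Tr rho D1 <-> forall s t, Cterm s -> Cterm t -> Dt (EQ s t).
  Proof.
    unfold D1. rewrite sat_AllC2. do 4 (apply all_congr; intro). rewrite sat_D. reflexivity.
  Qed.
  Lemma sat_D2 rho : sat M Tr rho D2 <->
    forall t x, Cterm t -> IsVal t x -> (Dt (TR t) <-> Dt x).
  Proof.
    apply sat_AllC_value. intros t x Ht Hx.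
    rewrite sat_iff, sat_D, sat_Dval, value_iff by exact Hx. reflexivity.
  Qed.
  Lemma sat_D3 rho : sat M Tr rho D3 <->
    forall t x, Cterm t -> IsVal t x -> (Dt (DC t) <-> Dt x).
  Proof.
    apply sat_AllC_value. intros t x Ht Hx.
    rewrite sat_iff, sat_D, sat_Dval, value_iff by exact Hx.
    unfold dD, dat, dsub. cbn [eval]. rewrite eval_numeral. reflexivity.
  Qed.
  Lemma sat_D4 rho : sat M Tr rho D4 <-> forall u, IsForm zer u -> (Dt (NEG u) <-> Dt u).
  Proof.
    unfold D4. rewrite sat_AllS. do 2 (apply all_congr; intro).
    rewrite sat_iff, !sat_D. reflexivity.
  Qed.
  Lemma sat_D5 rho : sat M Tr rho D5 <->
    forall u w, IsForm zer u -> IsForm zer w -> (Dt (AND u w) <->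
      (Dt u /\ Dt w) \/ (Dt u /\ Tr (NEG u)) \/ (Dt w /\ Tr (NEG w))).
  Proof.
    unfold D5. rewrite sat_AllS2. do 4 (apply all_congr; intro).
    rewrite sat_iff, !sat_or. cbn [sat]. rewrite !sat_D. reflexivity.
  Qed.
  Lemma sat_D6 rho : sat M Tr rho D6 <->
    forall u, IsForm one u -> (Dt (ALL u) <->
      (forall t, Cterm t -> Dt (SUB zer u t)) \/
      (exists t, Cterm t /\ Dt (SUB zer u t) /\ Tr (NEG (SUB zer u t)))).
  Proof.
    unfold D6. rewrite sat_AllF. do 2 (apply all_congr; intro).
    rewrite sat_iff, sat_or, sat_AllC, sat_ExC. cbn [sat]. setoid_rewrite sat_D. reflexivity.
  Qed.
  Lemma sat_R2 rho : sat M Tr rho R2 <->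
    forall u s t, IsForm one u -> Cterm s -> Cterm t -> EV s t ->
      (Dt (SUB zer u s) <-> Dt (SUB zer u t)).
  Proof.
    unfold R2. rewrite sat_AllF.
    transitivity (forall u, IsForm one u -> forall s t, Cterm s -> Cterm t -> EV s t ->
      (Dt (SUB zer u s) <-> Dt (SUB zer u t))); [|split; auto].
    do 2 (apply all_congr; intro). rewrite sat_AllC2. do 4 (apply all_congr; intro).
    rewrite sat_imp, sat_iff, sat_eqval, !sat_D. reflexivity.
  Qed.
End Model.

(** * The axioms are sentences *)

(** Numerals of codes of formulas are far too large to be computed, hence terms built
    with [dat] are kept folded in what follows. *)

Lemma below_lift k n t : term_below n t -> term_below (k + n) (t ↑ k).
Proof. intros H. apply term_below_subst with n; [exact H|]. intros i Hi. cbn. lia. Qed.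

Lemma below_v n i : i < n -> term_below n (v i).
Proof. exact (fun H => H). Qed.

Lemma below_dat n A t : term_below n t -> term_below n (dat A t).
Proof. intros H. exact (conj I (conj (below_numeral n (code A)) H)). Qed.

Ltac below_step :=
  match goal with
  | |- _ /\ _ => split
  | |- True => exact I
  | |- _ < _ => lia
  | H : term_below ?n ?t |- term_below ?n ?t => exact H
  | |- term_below _ (lift ?k _) => refine (below_lift k _ _ _)
  | |- term_below _ (numeral _) => apply below_numeral
  | |- term_below _ (v _) => apply below_v
  | |- term_below _ (dat _ _) => apply below_dat
  | |- term_below _ (dF _) => apply below_dat
  | |- term_below _ (dD _) => apply below_dat
  | |- _ => progress cbn [form_below term_below
        Or Imp Iff Ex disj map fold_right fn1s fn2s fn3s num1 num2 num3
        succ num dtr dneg dall deq dand dsub pr cvar czero cap1 cap2 cap3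
        le lt mem inw term_step form_step val_step is_node at_ Fls
        AllC ExC AllS AllF TTc TFc TT TF Tval Dval]
  end.
Ltac below := repeat below_step.

Lemma below_isTerm n k x : term_below n k -> term_below n x -> form_below n (isTerm k x).
Proof. intros Hk Hx. unfold isTerm. below. Qed.

Lemma below_isForm n k x : term_below n k -> term_below n x -> form_below n (isForm k x).
Proof.
  intros Hk Hx. unfold isForm.
  repeat match goal with
    | |- form_below _ (isTerm _ _) => apply below_isTerm
    | _ => below_step
    end.
Qed.

Lemma below_isVal n x y : term_below n x -> term_below n y -> form_below n (isVal x y).
Proof. intros Hx Hy. unfold isVal. below. Qed.

Lemma below_eqval n s t : term_below n s -> term_below n t -> form_below n (eqval s t).
Proof.
  intros Hs Ht. unfold eqval.
  repeat match goal with
    | |- form_below _ (isVal _ _) => apply below_isVal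
    | _ => below_step
    end.
Qed.

Ltac below_axiom := repeat
  match goal with
  | |- form_below _ (isCterm _) => apply below_isTerm
  | |- form_below _ (isSent _) => apply below_isForm
  | |- form_below _ (isForm1 _) => apply below_isForm
  | |- form_below _ (isVal _ _) => apply below_isVal
  | |- form_below _ (eqval _ _) => apply below_eqval
  | |- form_below _ (D _) => apply below_D
  | _ => below_step
  end.

Lemma form_below_foralls n A : forall m, form_below (n + m) A -> form_below m (foralls n A).
Proof.
  induction n as [|n IH]; cbn [foralls form_below]; intros m HA; [exact HA|].
  apply IH. now replace (n + S m) with (S n + m) by lia.
Qed.

Lemma PA_sentence A : PA A -> sentence A.
Proof.
  unfold sentence. intros [H|[H|(n & B & HB & ->)]].
  - unfold arith_axioms in H. cbn [In] in H.
    repeat (destruct H as [<-|H]; [solve [below]|]). destruct H.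
  - unfold syntax_axioms in H. cbn [In] in H.
    repeat (destruct H as [<-|H]; [solve [below]|]). destruct H.
  - apply form_below_foralls. now rewrite Nat.add_0_r.
Qed.

Lemma Tsent_sentence : sentence Tsent.
Proof. unfold sentence, Tsent. below_axiom. Qed.

Lemma CDT_sentence A : CDT A -> sentence A.
Proof.
  intros [H|[->|H]]; [now apply PA_sentence|exact Tsent_sentence|].
  unfold sentence. cbn [In] in H.
  repeat (destruct H as [<-|H];
    [unfold T1, T2p, T3, T4, T5, T6, D1, D2, D3, D4, D5, D6, R1, R2;
     solve [below_axiom]|]).
  destruct H.
Qed.

Lemma CKFcs_sentence A : CKFcs A -> sentence A.
Proof.
  intros [H|[->|H]]; [now apply PA_sentence|exact Tsent_sentence|].
  unfold sentence. cbn [In] in H.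
  repeat (destruct H as [<-|H];
    [unfold T1, T4, T5, T6, R1, T7, T8, T9, T10, T11, T12, T13, T14, T15, TDel;
     solve [below_axiom]|]).
  destruct H.
Qed.

(** * The equivalence *)

Tactic Notation "member" integer(k) := do k right; left; reflexivity.

Lemma model_CKFcs_CDT M Tr : model M Tr CKFcs -> model M Tr CDT.
Proof.
  intros HM.
  assert (HPA : model M Tr PA) by (intros A HA; apply HM; now left).
  assert (HT : forall rho A, In A [Tsent; T1; T4; T5; T6; R1] -> sat M Tr rho A).
  { intros rho A HA. apply HM. cbn [In] in HA.
    destruct HA as [<-|[<-|[<-|[<-|[<-|[<-|[]]]]]]]; [now right; left|..]; right; right.
    - member 0.
    - member 1.
    - member 2.
    - member 3.
    - member 4. }
  pose (rho0 := fun _ : nat => i0 M).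
  assert (HC : compositional M Tr) by exact (compositional_sat M Tr HPA rho0 (HT rho0)).
  assert (H : KF M Tr).
  { constructor.
    - apply (sat_T7 M Tr HPA rho0), HM. right. right. member 5.
    - apply (sat_T8 M Tr HPA HC rho0), HM. right. right. member 6.
    - apply (sat_T9 M Tr HPA rho0), HM. right. right. member 7.
    - apply (sat_T10 M Tr HPA rho0), HM. right. right. member 8.
    - apply (sat_T11 M Tr HPA HC rho0), HM. right. right. member 9.
    - apply (sat_T12 M Tr HPA HC rho0); [below_axiom|]. apply HM. right. right. member 10.
    - apply (sat_T13 M Tr HPA HC rho0); [below_axiom|]. apply HM. right. right. member 11.
    - apply (sat_T14 M Tr HPA HC rho0), HM. right. right. member 12.
    - apply (sat_T15 M Tr HPA HC rho0), HM. right. right. member 13.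
    - apply (sat_TDel M Tr HPA HC rho0), HM. right. right. member 14. }
  apply (KF_CD M Tr HPA HC) in H.
  intros A [HA|[->|HA]] rho; [now apply HPA|apply HT; member 0|].
  cbn [In] in HA. repeat (destruct HA as [<-|HA]; [|]); [..|destruct HA].
  - apply HT. member 1.
  - apply (sat_T2p M Tr HPA HC), H.
  - apply (sat_T3 M Tr HPA HC), H.
  - apply HT. member 2.
  - apply HT. member 3.
  - apply HT. member 4.
  - apply (sat_D1 M Tr HPA HC), H.
  - apply (sat_D2 M Tr HPA HC), H.
  - apply (sat_D3 M Tr HPA HC), H.
  - apply (sat_D4 M Tr HPA HC), H.
  - apply (sat_D5 M Tr HPA HC), H.
  - apply (sat_D6 M Tr HPA HC), H.
  - apply HT. member 5.
  - apply (sat_R2 M Tr HPA HC), H.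
Qed.

Lemma model_CDT_CKFcs M Tr : model M Tr CDT -> model M Tr CKFcs.
Proof.
  intros HM.
  assert (HPA : model M Tr PA) by (intros A HA; apply HM; now left).
  assert (HT : forall rho A, In A [Tsent; T1; T4; T5; T6; R1] -> sat M Tr rho A).
  { intros rho A HA. apply HM. cbn [In] in HA.
    destruct HA as [<-|[<-|[<-|[<-|[<-|[<-|[]]]]]]]; [now right; left|..]; right; right.
    - member 0.
    - member 3.
    - member 4.
    - member 5.
    - member 12. }
  pose (rho0 := fun _ : nat => i0 M).
  assert (HC : compositional M Tr) by exact (compositional_sat M Tr HPA rho0 (HT rho0)).
  assert (H : CD M Tr).
  { constructor.
    - apply (sat_T2p M Tr HPA HC rho0), HM. right. right. member 1.
    - apply (sat_T3 M Tr HPA HC rho0), HM. right. right. member 2.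
    - apply (sat_D1 M Tr HPA HC rho0), HM. right. right. member 6.
    - apply (sat_D2 M Tr HPA HC rho0), HM. right. right. member 7.
    - apply (sat_D3 M Tr HPA HC rho0), HM. right. right. member 8.
    - apply (sat_D4 M Tr HPA HC rho0), HM. right. right. member 9.
    - apply (sat_D5 M Tr HPA HC rho0), HM. right. right. member 10.
    - apply (sat_D6 M Tr HPA HC rho0), HM. right. right. member 11.
    - apply (sat_R2 M Tr HPA HC rho0), HM. right. right. member 13. }
  apply (CD_KF M Tr HPA HC) in H.
  intros A [HA|[->|HA]] rho; [now apply HPA|apply HT; member 0|].
  cbn [In] in HA. repeat (destruct HA as [<-|HA]; [|]); [..|destruct HA].
  - apply HT. member 1.
  - apply HT. member 2.
  - apply HT. member 3.
  - apply HT. member 4.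
  - apply HT. member 5.
  - apply (sat_T7 M Tr HPA), H.
  - apply (sat_T8 M Tr HPA HC), H.
  - apply (sat_T9 M Tr HPA), H.
  - apply (sat_T10 M Tr HPA), H.
  - apply (sat_T11 M Tr HPA HC), H.
  - apply (sat_T12 M Tr HPA HC); [below_axiom|apply H].
  - apply (sat_T13 M Tr HPA HC); [below_axiom|apply H].
  - apply (sat_T14 M Tr HPA HC), H.
  - apply (sat_T15 M Tr HPA HC), H.
  - apply (sat_TDel M Tr HPA HC), H.
Qed.

Theorem mainTheorem4 :
  forall A : form, sentence A -> (proves CDT A <-> proves CKFcs A).
Proof.
  intros A _. split; apply deriv_cut_theory; intros B HB.
  - apply completeness; [exact CKFcs_sentence|]. intros M Tr HM.
    now apply (model_CKFcs_CDT M Tr HM).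
  - apply completeness; [exact CDT_sentence|]. intros M Tr HM.
    now apply (model_CDT_CKFcs M Tr HM).
Qed.
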